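(* Let $f:\mathbb{R}^n\to\mathbb{R}$, $g:\mathbb{R}^m\to\mathbb{R}$ be convex and twice continuously differentiable with Lipschitz continuous gradients, let $A\in\mathbb{R}^{m\times n}$ have full column rank, and suppose $\phi(x)\equiv f(x)+g(Ax)$ has a finite global minimum. Let $\alpha>0$, $r>0$. For $\rho>0$ consider the iteration $$x_{k+1}=\operatorname{argmin}_{x}\Big\{\rho^{-1}f(x)+\tfrac12\|Ax-(\hat z_k-\hat u_k)\|^2\Big\},$$ $$z_{k+1}=\operatorname{argmin}_{z}\Big\{\rho^{-1}g(z)+\tfrac12\|z-(\alpha Ax_{k+1}+(1-\alpha)\hat z_k+\hat u_k)\|^2\Big\},$$ $$u_{k+1}=\hat u_k+\alpha Ax_{k+1}+(1-\alpha)\hat z_k-z_{k+1},$$ $$\hat u_{k+1}=u_{k+1}+\gamma_{k+1}(u_{k+1}-u_k),\qquad\hat z_{k+1}=z_{k+1}+\gamma_{k+1}(z_{k+1}-z_k),$$ with either $\gamma_{k+1}=\dfrac{k+\sqrt\rho}{k+r+\sqrt\rho}$ (the R-A-ADMM method) or $\gamma_{k+1}=1-r/\sqrt\rho$ for all $k$ (the R-HB-ADMM method), and let $\epsilon\equiv\rho^{-1/2}$. Then the perturbed differential equation modeling each of these algorithms, accurate up to $O(\epsilon^2)$ (in the sense given in the context), has the form $$\frac{A^TA}{\alpha}\big[\ddot X+a(t)\dot X\big]+\epsilon\,\nabla^2\phi(X)\,\dot X=-\big(1+\epsilon\,b(t)\big)\nabla\phi(X),\qquad X\equiv X(t).$$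 For the R-A-ADMM method the coefficients are $$a(t)=\frac{r}{t+1}-\frac{\epsilon\,r(r-2)}{2(t+1)^2},\qquad b(t)=\frac{r}{2(t+1)},$$ while for the R-HB-ADMM method the coefficients are the constants $$a(t)=r+\frac{\epsilon r^2}{2},\qquad b(t)=\frac r2 .$$
   Context: Initialization of the algorithms: $\hat z_0=z_0=Ax_0$, $\hat u_0=u_0=0$. Sense of the approximation. With grid $t_k=\epsilon k$, the iterates are identified with sufficiently smooth functions of time, $x_k\approx X(t_k)$, $z_k\approx Z(t_k)$, $u_k\approx U(t_k)$, $\hat z_k\approx\hat Z(t_k)$, $\hat u_k\approx\hat U(t_k)$, shifts such as $x_{k+1}\approx X(t_k+\epsilon)$ are expanded in Taylor series in $\epsilon$, and the perturbed (modified) differential equation is the equation for $X$ that the update rules imply when terms of order $O(\epsilon^2)$ are dropped (the leading-order equation keeps only the terms of order $\epsilon^0$). The modified equation models the algorithm up to a discrepancy $\|X(t_k)-x_k\|=O(\epsilon^2)$. *)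

(* Defs.v *)
(* `|v| on vectors is the library (sup) norm: it is used only in Lipschitz
   bounds and O(eps^2) bounds, which do not depend on the choice of a norm.
   The quadratic terms minimized by the algorithm use the Euclidean norm. *)
From mathcomp Require Import all_boot all_order all_algebra.
From mathcomp Require Import all_classical all_reals all_analysis.

Set Implicit Arguments.
Unset Strict Implicit.
Unset Printing Implicit Defensive.

Import Order.TTheory GRing.Theory Num.Theory.
Import numFieldNormedType.Exports.
Local Open Scope classical_set_scope.
Local Open Scope ring_scope.

Section calculus.
Context {R : realType}.

Definition sqnorm2 n (v : 'cV[R]_n) : R := \sum_i v i 0 ^+ 2.

Definition gradient n (f : 'cV[R]_n -> R) (x : 'cV[R]_n) : 'cV[R]_n :=
  \col_i 'D_(delta_mx i 0) f x.

Definition hessian n (f : 'cV[R]_n -> R) (x : 'cV[R]_n) : 'M[R]_n :=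
  \matrix_(i, j) 'D_(delta_mx j 0) (fun y => gradient f y i 0) x.

Definition twice_continuously_differentiable n (f : 'cV[R]_n -> R) : Prop :=
  [/\ forall x, differentiable f x,
      forall x, differentiable (gradient f) x &
      continuous (hessian f)].

Definition is_argmin n (F : 'cV[R]_n -> R) (x : 'cV[R]_n) : Prop :=
  forall y, F x <= F y.

(* A family of curves indexed by rho, of class "N derivatives, bounded on
   [t0, T] uniformly in (large) rho". *)
Definition smooth_family n (N : nat) (t0 T : R) (Y : R -> R -> 'cV[R]_n) : Prop :=
  exists M : R, \forall rho \near +oo, forall t, t0 <= t <= T ->
    (forall j, (j < N)%N -> derivable (Y rho)^`(j)%classic t 1) /\
    (forall j, (j <= N)%N -> `|(Y rho)^`(j)%classic t| <= M).

End calculus.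

Section admm.
Context {R : realType} {n m : nat}.
Variables (f : 'cV[R]_n -> R) (g : 'cV[R]_m -> R) (A : 'M[R]_(m, n)).
Variable alpha : R.

Definition objective (x : 'cV[R]_n) : R := f x + g (A *m x).

(* [gam k] is the extrapolation coefficient gamma_{k+1}. *)
Record admm_iterates (rho : R) (gam : nat -> R) (x0 : 'cV[R]_n)
    (x : nat -> 'cV[R]_n) (z u zh uh : nat -> 'cV[R]_m) : Prop := {
  admm_x0 : x 0%N = x0;
  admm_z0 : z 0%N = A *m x0;
  admm_u0 : u 0%N = 0;
  admm_zh0 : zh 0%N = z 0%N;
  admm_uh0 : uh 0%N = u 0%N;
  admm_xS : forall k, is_argmin
    (fun y => rho^-1 * f y + 2^-1 * sqnorm2 (A *m y - (zh k - uh k))) (x k.+1);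
  admm_zS : forall k, is_argmin
    (fun y => rho^-1 * g y + 2^-1 *
       sqnorm2 (y - (alpha *: (A *m x k.+1) + (1 - alpha) *: zh k + uh k)))
    (z k.+1);
  admm_uS : forall k,
    u k.+1 = uh k + alpha *: (A *m x k.+1) + (1 - alpha) *: zh k - z k.+1;
  admm_uhS : forall k, uh k.+1 = u k.+1 + gam k *: (u k.+1 - u k);
  admm_zhS : forall k, zh k.+1 = z k.+1 + gam k *: (z k.+1 - z k) }.

Definition ode_lhs (eps : R) (a : R -> R) (X : R -> 'cV[R]_n) (t : R) : 'cV[R]_n :=
  (alpha^-1 *: (A^T *m A)) *m (X^`(2)%classic t + a t *: X^`()%classic t)
  + eps *: (hessian objective (X t) *m X^`()%classic t).

Definition ode_rhs (eps : R) (b : R -> R) (X : R -> 'cV[R]_n) (t : R) : 'cV[R]_n :=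
  - ((1 + eps * b t) *: gradient objective (X t)).

Definition ode_solution (eps : R) (a b : R -> R) (t0 T : R)
    (Y : R -> 'cV[R]_n) : Prop :=
  forall t, t0 <= t <= T ->
    [/\ derivable Y t 1, derivable Y^`()%classic t 1 &
        ode_lhs eps a Y t = ode_rhs eps b Y t].

Definition step (rho : R) : R := (Num.sqrt rho)^-1.

(* The algorithm with coefficients [gam rho] is modeled, up to O(eps^2) with
   eps = step rho -> 0, by the equation with coefficients [a eps] and [b].
   Suppose the iterates with eps * k in [t0, T] are the values at eps * k of
   smooth curves X, Z, U, Zh, Uh.  Then X satisfies the equation with a residual
   O(eps^2), and the solutions of the equation whose initial data match those
   of X stay at distance O(eps^2) from the iterates x_k.

   - The gradients along the curves are Taylor-expanded too, so they belong to
     the smoothness assumption: for f and g merely of class C^2, smoothness of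
     X and Z does not imply it, and the remainders would only be o(eps).
   - t0 = 0 is allowed; t0 > 0 covers sequences that are smooth only after the
     initial layer due to u_0 = 0 (whereas u_k = eps^2 grad g(z_k) for k > 0). *)
Definition modified_equation (gam : R -> nat -> R) (a : R -> R -> R) (b : R -> R)
    : Prop :=
  forall (x0 : 'cV[R]_n) (t0 T : R)
    (x : R -> nat -> 'cV[R]_n) (z u zh uh : R -> nat -> 'cV[R]_m)
    (X : R -> R -> 'cV[R]_n) (Z U Zh Uh : R -> R -> 'cV[R]_m),
  0 <= t0 -> t0 < T ->
  (forall rho, 0 < rho ->
     admm_iterates rho (gam rho) x0 (x rho) (z rho) (u rho) (zh rho) (uh rho)) ->
  (\forall rho \near +oo, forall k : nat, t0 <= step rho * k%:R <= T ->
     [/\ X rho (step rho * k%:R) = x rho k,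
         Z rho (step rho * k%:R) = z rho k,
         U rho (step rho * k%:R) = u rho k,
         Zh rho (step rho * k%:R) = zh rho k &
         Uh rho (step rho * k%:R) = uh rho k]) ->
  smooth_family 4 t0 T X -> smooth_family 4 t0 T Z -> smooth_family 4 t0 T U ->
  smooth_family 4 t0 T Zh -> smooth_family 4 t0 T Uh ->
  smooth_family 2 t0 T (fun rho t => gradient objective (X rho t)) ->
  smooth_family 2 t0 T (fun rho t => gradient g (Z rho t)) ->
  (exists C : R, \forall rho \near +oo, forall t, t0 <= t <= T ->
     `|ode_lhs (step rho) (a (step rho)) (X rho) t
       - ode_rhs (step rho) b (X rho) t| <= C * step rho ^+ 2) /\
  (forall Y : R -> R -> 'cV[R]_n,
     (\forall rho \near +oo,
        ode_solution (step rho) (a (step rho)) b t0 T (Y rho)) ->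
     (exists K : R, \forall rho \near +oo,
        `|Y rho t0 - X rho t0| <= K * step rho ^+ 2 /\
        `|(Y rho)^`()%classic t0 - (X rho)^`()%classic t0| <= K * step rho ^+ 2) ->
     exists C : R, \forall rho \near +oo, forall k : nat,
       t0 <= step rho * k%:R <= T ->
       `|Y rho (step rho * k%:R) - x rho k| <= C * step rho ^+ 2).

End admm.

(* Main.v *)
(* Eliminating u_k = eps^2 grad g (z_k) (valid for k > 0) from the optimality
   conditions leaves, with D_k y = y_{k+2} - y_{k+1} - gamma (y_{k+1} - y_k),
     A x_{k+2} - z_{k+2} = (1/alpha - 1) D_k z + (eps^2/alpha) D_k (grad g (z))
   and a second relation
     (1/alpha) A^T D_k z + eps^2 grad phi (x_{k+2}) = O(eps^4).
   Writing 1 - gamma = eps c(t) + eps^2 d(t) + O(eps^3), Taylor expansion gives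
     D_k y = eps^2 (y'' + c y' + eps (d y' - c/2 y'')) + O(eps^4),
   so the gap A x - z is an O(eps^2) smooth quantity, on which D_k is O(eps^4), and
   z may be replaced by A x.  Multiplying the resulting equation by 1 + eps c/2
   removes eps x'' and yields a = c + eps (d + c^2/2) and b = c/2.  The residual is
   thus O(eps^2) on the grid, hence everywhere by interpolation, and a Gronwall
   argument bounds the distance to the solutions. *)
Require Import Defs.
From mathcomp Require Import all_boot all_order all_algebra.
From mathcomp Require Import all_classical all_reals all_analysis.
From mathcomp Require Import ring lra.

Set Implicit Arguments.
Unset Strict Implicit.
Unset Printing Implicit Defensive.

Import Order.TTheory GRing.Theory Num.Theory.
Import numFieldNormedType.Exports.
Local Open Scope classical_set_scope.
Local Open Scope ring_scope.

(** The Hessian term has a discrete origin: $D_k x$ is centred at node $k+1$ while the gradient sits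
    at $x_{k+2}$, so expanding it one step back yields
    $\epsilon\frac{d}{dt}\nabla\phi(X)=\epsilon\nabla^2\phi(X)\dot X$. Two obstacles shape the
    proof. Differencing a sequence of which only the size is known gains no power of $\epsilon$, so
    the bound $O(\epsilon^2)$ on $Ax-z$ cannot by itself give $O(\epsilon^4)$ for its damped
    difference. Estimates therefore record regularity as well as size, in classes on which $D_k$
    gains zero, one or two powers of $\epsilon$, and the gap is split into $\epsilon^2$ times a
    smooth curve and an $O(\epsilon^4)$ remainder. Moreover, the scheme yields the residual only at
    nodes with enough neighbours inside $[t_0,T]$. Near the ends of the interval it has to be
    extrapolated, and from two neighbouring nodes, since comparison with a single one would lose a
    power of $\epsilon$. *)

Section column_norm.
Context {R : realType}.

(** * Sup norm of columns and derivatives of linear maps *)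

Lemma coord_le_norm n (v : 'cV[R]_n) i : `|v i 0| <= `|v|.
Proof.
by rewrite [leRHS]/Num.Def.normr/= mx_normrE; exact: (le_bigmax _ _ (i, 0)).
Qed.

Lemma norm_le_coord n (v : 'cV[R]_n) e :
  0 <= e -> (forall i, `|v i 0| <= e) -> `|v| <= e.
Proof.
move=> e0 H; rewrite [leLHS]/Num.Def.normr/= mx_normrE.
by apply: bigmax_le => // -[i j] _ /=; rewrite (ord1 j).
Qed.

Lemma mulmx_norm_le m n (B : 'M[R]_(m, n)) :
  exists2 k, 0 <= k & forall v : 'cV[R]_n, `|B *m v| <= k * `|v|.
Proof.
exists (\sum_i \sum_j `|B i j|) => [|v].
  by apply: sumr_ge0 => i _; apply: sumr_ge0.
have S0 i : 0 <= \sum_j `|B i j| by apply: sumr_ge0.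
apply: norm_le_coord => [|i]; first by rewrite mulr_ge0 // sumr_ge0.
rewrite mxE (le_trans (ler_norm_sum _ _ _)) //.
have H : \sum_j `|B i j * v j 0| <= (\sum_j `|B i j|) * `|v|.
  rewrite mulr_suml; apply: ler_sum => j _.
  by rewrite normrM ler_wpM2l // coord_le_norm.
apply: le_trans H _; rewrite ler_wpM2r // [leRHS](bigD1 i) //= lerDl.
by apply: sumr_ge0.
Qed.

Lemma mulmx_differentiable m n (B : 'M[R]_(m, n)) (x : 'cV[R]_n) :
  differentiable (mulmx B : 'cV[R]_n -> 'cV[R]_m) x.
Proof.
apply: linear_differentiable; apply: bounded_linear_continuous.
apply/linear_boundedP; have [k k0 Bk] := mulmx_norm_le B.
by near=> r => v; apply: le_trans (Bk v) _; rewrite ler_wpM2r.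
Unshelve. all: by end_near. Qed.

Lemma is_derive_mulmx m n (B : 'M[R]_(m, n)) (y : R -> 'cV[R]_n) (t : R)
    (dy : 'cV[R]_n) :
  is_derive t 1 y dy -> is_derive t 1 (fun s => B *m y s) (B *m dy).
Proof.
move=> dyt; have yt : differentiable y t by apply/derivable1_diffP.
have Bt := mulmx_differentiable B (y t).
apply: DeriveDef; first by apply/derivable1_diffP; exact: differentiable_comp.
rewrite deriveE; last exact: differentiable_comp.
rewrite diff_comp //= (diff_lin (f := mulmx B)).
  by rewrite -deriveE // derive_val.
by move=> z; apply: differentiable_continuous; exact: mulmx_differentiable.
Qed.

Lemma is_derive_coord m n (y : R -> 'M[R]_(m, n)) (t : R)
    (dy : 'M[R]_(m, n)) i j :
  is_derive t 1 y dy -> is_derive t 1 (fun s => y s i j) (dy i j).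
Proof.
move=> dyt; apply: DeriveDef; first by have /derivable_mxP := @ex_derive _ _ _ _ _ _ _ dyt.
by have /derive_mx := @ex_derive _ _ _ _ _ _ _ dyt; rewrite derive_val => ->; rewrite mxE.
Qed.

Lemma derive_col n (F : 'cV[R]_n -> R) x v : differentiable F x ->
  'D_v F x = \sum_j v j 0 * 'D_(delta_mx j 0) F x.
Proof.
move=> dF; rewrite deriveE // {1}[v]matrix_sum_delta exchange_big big_ord1.
by rewrite linear_sum; apply: eq_bigr => j _; rewrite linearZ /= -deriveE.
Qed.

End column_norm.

(** * Chain rules for gradients and first-order optimality *)

Section gradients.
Context {R : realType}.

Lemma is_derive_comp (V W : normedModType R) (F : V -> W) (y : R -> V)
    (t : R) (dy : V) :
  differentiable F (y t) -> is_derive t 1 y dy ->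
  is_derive t 1 (fun s => F (y s)) ('D_dy F (y t)).
Proof.
move=> dF dyt; have yt : differentiable y t by apply/derivable1_diffP.
have Fy : differentiable (F \o y) t by exact: differentiable_comp.
apply: DeriveDef; first by apply/derivable1_diffP.
have yt1 : 'd y t 1 = dy by rewrite -deriveE // derive_val.
by rewrite deriveE // diff_comp //= yt1 -deriveE.
Qed.

Lemma is_derive_fsum n (F : 'I_n -> R -> R) (dF : 'I_n -> R) (t : R) :
  (forall i, is_derive t 1 (F i) (dF i)) ->
  is_derive t 1 (fun s => \sum_i F i s) (\sum_i dF i).
Proof.
move=> FP; have := is_derive_sum FP; congr is_derive.
by apply/funext => s; rewrite fct_sumE.
Qed.

Lemma is_derive_line (V : normedModType R) (x v : V) (t : R) :
  is_derive t 1 (fun s : R => s *: v + x) v.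
Proof.
have lt : differentiable (fun s : R => s *: v + x) t by [].
apply: DeriveDef; first by apply/derivable1_diffP.
by rewrite deriveE // diff_val /= addr0 scale1r.
Qed.

Lemma gradient_objective n m (f : 'cV[R]_n -> R) (g : 'cV[R]_m -> R)
    (A : 'M[R]_(m, n)) (x : 'cV[R]_n) :
  differentiable f x -> differentiable g (A *m x) ->
  gradient (objective f g A) x = gradient f x + A^T *m gradient g (A *m x).
Proof.
move=> df dg; have dA := mulmx_differentiable A x.
have dgA : differentiable (g \o mulmx A) x by exact: differentiable_comp.
have dAv v : 'd (mulmx A) x v = A *m v.
  rewrite (diff_lin (f := mulmx A)) // => z.
  exact: differentiable_continuous (mulmx_differentiable A z).
apply/colP => j; rewrite !mxE.
rewrite (_ : objective f g A = f + (g \o mulmx A)) // deriveD; last first.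
- exact: diff_derivable.
- exact: diff_derivable.
congr (_ + _); rewrite [LHS]deriveE // diff_comp //= dAv -deriveE // derive_col //.
by apply: eq_bigr => i _; rewrite -colE !mxE.
Qed.

Lemma is_derive_gradient n (f : 'cV[R]_n -> R) (y : R -> 'cV[R]_n) (t : R)
    (dy : 'cV[R]_n) :
  differentiable (gradient f) (y t) -> is_derive t 1 y dy ->
  is_derive t 1 (fun s => gradient f (y s)) (hessian f (y t) *m dy).
Proof.
move=> dG dyt; apply: is_derive_eq.
  exact: is_derive_comp dG dyt.
apply/colP => i; rewrite derive_mx; last exact: diff_derivable.
rewrite !mxE derive_col.
  by apply: eq_bigr => j _; rewrite mxE mulrC.
apply: (differentiable_comp (f := gradient f) (g := fun v : 'cV_n => v i 0)) => //.
exact: differentiable_coord.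
Qed.

(** Fermat's rule along the coordinate lines through [x]: the restriction [h] of the objective to
    such a line is minimal at 0, and [h'(0)] is the corresponding coordinate of the left-hand
    side. *)
Lemma argmin_prox_gradient n m (c : R) (f : 'cV[R]_n -> R) (B : 'M[R]_(m, n))
    (w : 'cV[R]_m) (x : 'cV[R]_n) :
  (forall y, differentiable f y) ->
  is_argmin (fun y => c * f y + 2^-1 * sqnorm2 (B *m y - w)) x ->
  c *: gradient f x + B^T *m (B *m x - w) = 0.
Proof.
move=> df xmin; apply/colP => j.
set v : 'cV[R]_n := delta_mx j 0.
pose q i : R -> R := fun s => s * (B *m v) i 0 + (B *m x - w) i 0.
have qE s : B *m (s *: v + x) - w = \col_i q i s.
  by apply/colP => i; rewrite /q mulmxDr -scalemxAr !mxE; ring.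
pose p i := (B *m v) i 0.
have dq i (t : R) : is_derive t 1 (q i) (p i).
  have -> : q i = (fun s : R => s *: p i + (B *m x - w) i 0) by [].
  exact: (is_derive_line (V := R^o)).
pose dh (t : R) := c * 'D_v f (t *: v + x) + 2^-1 * (\sum_i (q i t * p i *+ 2)).
pose h s := c * f (s *: v + x) + 2^-1 * sqnorm2 (B *m (s *: v + x) - w).
have dhP (t : R) : is_derive t 1 h (dh t).
  have H1 := is_derive_comp (df _) (is_derive_line x v t).
  have H2 : is_derive t 1 (fun s => \sum_i (q i s) ^+ 2) (\sum_i (q i t * p i *+ 2)).
    exact: is_derive_fsum.
  have -> : h = (c \*: (fun s : R => f (s *: v + x))) +
                (2^-1 \*: (fun s => \sum_i (q i s) ^+ 2)).
    apply/funext => s; rewrite /h /= !fctE /sqnorm2 qE; congr (_ + 2^-1 * _).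
    by apply: eq_bigr => i _; rewrite mxE.
  exact: is_deriveD (is_deriveZ _ H1) (is_deriveZ _ H2).
have : dh 0 = 0.
  rewrite -(@derive_val _ _ _ _ _ _ _ (dhP 0)); apply: derive_val.
  apply: (@derive1_at_min _ h (- 1) 1).
  - by lra.
  - by move=> t _; exact: (@ex_derive _ _ _ _ _ _ _ (dhP t)).
  - by rewrite in_itv /= ltr01 andbT oppr_lt0 ltr01.
  - by move=> t _; rewrite /h scale0r add0r; exact: xmin.
rewrite /dh scale0r add0r !mxE; apply: etrans; congr (_ + _).
rewrite mulr_sumr; apply: eq_bigr => i _.
by rewrite /q mul0r add0r /p /v -colE [col j B i 0]mxE [B^T j i]mxE; field.
Qed.

End gradients.

(** * Mean value inequality and Taylor expansion for vector-valued curves *)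

Section taylor.
Context {R : realType}.

Lemma is_derive_derive1 (V : normedModType R) (y : R -> V) (t : R) :
  derivable y t 1 -> is_derive t 1 y (y^`()%classic t).
Proof. by move=> yt; rewrite derive1E; exact: derivableP. Qed.

(** The mean value theorem is applied to each coordinate; its intermediate point varies with the
    coordinate, but the sup norm keeps the constant [M]. *)
Lemma mean_value_ineq n (y dy : R -> 'cV[R]_n) (a b M : R) :
  (forall t, a <= t <= b -> is_derive t 1 y (dy t)) ->
  (forall t, a <= t <= b -> `|dy t| <= M) ->
  forall s t, a <= s <= b -> a <= t <= b -> `|y t - y s| <= M * `|t - s|.
Proof.
move=> yP dyM s t sab tab.
have M0 : 0 <= M by apply: le_trans (dyM s sab).
wlog st : s t sab tab / s <= t => [H|].
  have [/H|/ltW/H] := leP s t; first exact.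
  by rewrite distrC (distrC t); exact.
apply: norm_le_coord => [|i]; first by rewrite mulr_ge0.
have inab u : s <= u <= t -> a <= u <= b.
  move: sab tab => /andP[? _] /andP[_ ?] /andP[? ?].
  by apply/andP; split; [apply: le_trans; eassumption|apply: le_trans; eassumption].
have dyi u : s <= u <= t -> is_derive u 1 (fun v => y v i 0) (dy u i 0).
  by move=> /inab ub; exact: is_derive_coord (yP u ub).
have [||c] := @MVT_segment R (fun v => y v i 0) (fun v => dy v i 0) s t st.
- by move=> u /[!in_itv]/= /andP[/ltW ? /ltW ?]; apply: dyi; apply/andP.
- apply: derivable_within_continuous => u /[!in_itv]/= ust.
  exact: (@ex_derive _ _ _ _ _ _ _ (dyi u ust)).
move=> /[!in_itv]/= cst; rewrite !mxE => ->; rewrite normrM ler_wpM2r //.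
by apply: le_trans (coord_le_norm _ _) _; apply: dyM; exact: inab.
Qed.

Lemma is_derive_scalel (V : normedModType R) (p : R -> R) (v : V) (t dp : R) :
  is_derive t 1 p dp -> is_derive t 1 (fun s => p s *: v) (dp *: v).
Proof.
move=> dpt; have dF : differentiable ( *:%R^~ v : R -> V) (p t) by [].
have := is_derive_comp dF dpt.
by rewrite deriveE // diff_val.
Qed.

(** Differentiation shifts the coefficient sequence; this is what lets the induction in
    [taylor_bound] pass from a curve to its derivative. *)
Lemma is_derive_taylor_sum (V : normedModType R) (v : nat -> V) N (s t : R) :
  is_derive t 1 (fun u => \sum_(j < N.+1) ((u - s) ^+ j / j`!%:R) *: v j)
    (\sum_(j < N) ((t - s) ^+ j / j`!%:R) *: v j.+1).
Proof.
have dp j : is_derive t 1 (fun u : R => (u - s) ^+ j.+1 / j.+1`!%:R)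
    ((t - s) ^+ j / j`!%:R).
  have ds : is_derive t 1 (fun u : R => u - s) 1.
    have -> : (fun u : R => u - s) = (fun u => u *: (1 : R) - s).
      by apply/funext => u; rewrite /GRing.scale /= mulr1.
    exact: (is_derive_line (V := R)).
  have := is_deriveZ (j.+1`!%:R^-1 : R) (is_deriveX j.+1 ds).
  have <- : (fun u : R => (u - s) ^+ j.+1 / j.+1`!%:R) =
     (j.+1`!%:R^-1 : R) \*: (fun u : R => u - s) ^+ j.+1.
    by apply/funext => u; rewrite !fctE /GRing.scale /= mulrC.
  congr is_derive; rewrite /GRing.scale /= mulr1 factS natrM.
  have j1 : (1 + j%:R : R) != 0 by rewrite addrC natr1 pnatr_eq0.
  have jf : (j`!%:R : R) != 0 by rewrite pnatr_eq0 -lt0n fact_gt0.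
  by rewrite -(natr1 j); field; rewrite jf addrC.
elim: N => [|N IH].
  rewrite big_ord0; under eq_fun do rewrite big_ord1 expr0 fact0 divr1 scale1r.
  exact: is_derive_cst.
under eq_fun do rewrite big_ord_recr /=.
rewrite big_ord_recr /=; exact: is_deriveD IH (is_derive_scalel _ (dp N)).
Qed.

Lemma derive1nSr (V : normedModType R) (y : R -> V) j :
  derive1n j.+1 y = derive1n j y^`()%classic.
Proof. by rewrite derive1Sn. Qed.

(** Induction on the order: the derivative of the remainder of [y] is the remainder of [y'] one
    order lower. The mean value inequality bounds that derivative by its maximum instead of
    integrating it, so the constant is [M] and not [M / N!]. *)
Lemma taylor_bound n N (y : R -> 'cV[R]_n) (a b M : R) :
  (forall t, a <= t <= b -> forall j, (j < N)%N ->
     derivable (y^`(j)%classic) t 1) ->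
  (forall t, a <= t <= b -> `|y^`(N)%classic t| <= M) ->
  forall s t, a <= s <= b -> a <= t <= b ->
  `|y t - \sum_(j < N) ((t - s) ^+ j / j`!%:R) *: y^`(j)%classic s|
    <= M * `|t - s| ^+ N.
Proof.
elim: N y => [|N IH] y yD yM s t sab tab.
  by rewrite big_ord0 subr0 expr0 mulr1; exact: yM.
have M0 : 0 <= M by apply: le_trans (yM s sab).
pose w u := y u - \sum_(j < N.+1) ((u - s) ^+ j / j`!%:R) *: y^`(j)%classic s.
pose dw u := y^`()%classic u -
  \sum_(j < N) ((u - s) ^+ j / j`!%:R) *: y^`()%classic^`(j)%classic s.
have dwP u : a <= u <= b -> is_derive u 1 w (dw u).
  move=> uab; apply: is_deriveB.
    by apply: is_derive_derive1; exact: (yD u uab 0%N).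
  have := is_derive_taylor_sum (fun j => y^`(j)%classic s) N s u.
  by congr is_derive; apply: eq_bigr => j _; rewrite derive1nSr.
have dwM u : a <= u <= b -> `|dw u| <= M * `|u - s| ^+ N.
  move=> uab; apply: IH => // v vab => [j jN|]; rewrite -derive1nSr.
    exact: yD.
  exact: yM.
have ws : w s = 0.
  rewrite /w big_ord_recl subrr expr0 fact0 divr1 scale1r derive1n0 big1 ?addr0 ?subrr //.
  by move=> i _; rewrite expr0n /= mul0r scale0r.
rewrite exprSr mulrA -[X in `|X|]/(w t) -[w t]subr0 -ws.
(* The mean value inequality is used only between [s] and [t], where [|u - s|] is at most
   [|t - s|]. *)
pose lo := Num.min s t; pose hi := Num.max s t.
have [lol loh] : lo <= s <= hi /\ lo <= t <= hi.
  by rewrite /lo /hi !ge_min !le_max !lexx ?orbT.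
apply: (@mean_value_ineq _ w dw lo hi) => // u ust.
  apply: dwP; move: ust sab tab; rewrite /lo /hi ge_min le_max.
  by move=> /andP[/orP[]? /orP[]?] /andP[? ?] /andP[? ?]; apply/andP; split; lra.
apply: le_trans (dwM _ _) _.
  move: ust sab tab; rewrite /lo /hi ge_min le_max.
  by move=> /andP[/orP[]? /orP[]?] /andP[? ?] /andP[? ?]; apply/andP; split; lra.
rewrite ler_wpM2l // lerXn2r ?nnegrE //.
move: ust; rewrite /lo /hi; case: (leP s t) => st /andP[? ?].
  by rewrite !ger0_norm; lra.
by rewrite !ler0_norm; lra.
Qed.

End taylor.

(** * Gronwall inequality and stability of first-order systems *)

Section gronwall.
Context {R : realType}.

(** The function [(S u + e) * expR (- C * u)] is nonincreasing. The offset [e] absorbs the forcing,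
    which makes the differential inequality homogeneous. *)
Lemma gronwall (S dS : R -> R) (a b C e : R) :
  (forall t, a <= t <= b -> is_derive t 1 S (dS t)) ->
  (forall t, a <= t <= b -> dS t <= C * (S t + e)) ->
  forall t, a <= t <= b -> S t + e <= (S a + e) * expR (C * (t - a)).
Proof.
move=> SD SC t /andP[at_ tb].
pose h u := (S u + e) * expR (- C * u).
pose dh u := (dS u - C * (S u + e)) * expR (- C * u).
have hD u : a <= u <= b -> is_derive u 1 h (dh u).
  move=> uab.
  have H1 : is_derive u 1 (fun v => S v + e) (dS u).
    by have := is_deriveD (SD u uab) (is_derive_cst e u 1); rewrite addr0.
  have H2 : is_derive u 1 (fun v : R => - C * v) (- C).
    have := is_deriveZ (- C) (is_derive_id u 1).
    by rewrite /GRing.scale /= mulr1.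
  have H3 := is_derive1_comp (is_derive_expR (- C * u)) H2.
  have := is_deriveM H1 H3; congr is_derive.
  by rewrite /dh /GRing.scale /=; ring.
have : h t <= h a.
  have sub u : a <= u <= t -> a <= u <= b.
    by move=> /andP[-> ut]; exact: le_trans ut tb.
  have [|| u] := @MVT_segment R h dh a t at_.
  - by move=> u /[!in_itv]/= /andP[/ltW ? /ltW ?]; apply/hD/sub/andP.
  - apply: derivable_within_continuous => u /[!in_itv]/= /sub/hD uD.
    exact: (@ex_derive _ _ _ _ _ _ _ uD).
  move=> /[!in_itv]/= /sub uab huE; rewrite -subr_le0 huE.
  rewrite mulr_le0_ge0 ?subr_ge0 // mulr_le0_ge0 ?expR_ge0 //.
  by rewrite subr_le0 SC.
rewrite /h !mulNr => H.
have -> : expR (C * (t - a)) = expR (C * t) * expR (- (C * a)).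
  by rewrite -expRD mulrBr.
rewrite mulrA mulrAC -ler_pdivrMr ?expR_gt0 // -expRN //.
Qed.

Lemma sqnorm2_norm n (v : 'cV[R]_n) :
  `|v| ^+ 2 <= sqnorm2 v <= n%:R * `|v| ^+ 2.
Proof.
have S0 : 0 <= sqnorm2 v by apply: sumr_ge0 => i _; exact: sqr_ge0.
apply/andP; split.
  rewrite -[leRHS]sqr_sqrtr // lerXn2r ?nnegrE ?sqrtr_ge0 //.
  apply: norm_le_coord => [|i]; first exact: sqrtr_ge0.
  rewrite -sqrtr_sqr ler_wsqrtr // /sqnorm2 (bigD1 i) //= lerDl.
  by apply: sumr_ge0 => j _; exact: sqr_ge0.
have -> : n%:R * `|v| ^+ 2 = \sum_(i < n) `|v| ^+ 2.
  by rewrite sumr_const card_ord mulr_natl.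
apply: ler_sum => i _.
by rewrite -real_normK ?num_real // lerXn2r ?nnegrE // coord_le_norm.
Qed.

(** [K] is chosen before [e] and the curves, hence will be uniform in [rho]. The sup norm is not
    differentiable, so Gronwall is applied to the sum of the Euclidean squares of [E] and [V]. *)
Lemma stability n (a b B : R) : 0 <= B -> exists2 K : R, 0 <= K &
  forall (e : R) (E V dE dV : R -> 'cV[R]_n), 0 <= e ->
  (forall t, a <= t <= b ->
    [/\ is_derive t 1 E (dE t), is_derive t 1 V (dV t),
        `|dE t| <= B * (`|E t| + `|V t|) &
        `|dV t| <= B * (`|E t| + `|V t|) + e]) ->
  `|E a| <= e -> `|V a| <= e ->
  forall t, a <= t <= b -> `|E t| <= K * e.
Proof.
move=> B0; pose C := 1 + 6 * n%:R * B ^+ 2.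
have C1 : 1 <= C by rewrite lerDl !mulr_ge0 // sqr_ge0.
(* The 4 is 2 for the initial value of [S] plus 2 for the offset. *)
exists (Num.sqrt (4 * n%:R * expR (C * (b - a)))) => [|e E V dE dV e0 EV Ea Va t tab].
  exact: sqrtr_ge0.
pose S u := sqnorm2 (E u) + sqnorm2 (V u).
pose dS u := \sum_i (E u i 0 *: dE u i 0 + E u i 0 *: dE u i 0)
  + \sum_i (V u i 0 *: dV u i 0 + V u i 0 *: dV u i 0).
have sqD (y dy : R -> 'cV[R]_n) (u : R) : is_derive u 1 y (dy u) ->
    is_derive u 1 (fun v => sqnorm2 (y v))
      (\sum_i (y u i 0 *: dy u i 0 + y u i 0 *: dy u i 0)).
  move=> yD; rewrite /sqnorm2; apply: is_derive_fsum => i.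
  have H := is_derive_coord i 0 yD.
  exact: (is_deriveM H H).
have SD (u : R) : a <= u <= b -> is_derive u 1 S (dS u).
  by move=> /EV[? ? _ _]; apply: is_deriveD; exact: sqD.
have sq_dot (v w : 'cV[R]_n) : \sum_i (v i 0 *: w i 0 + v i 0 *: w i 0)
    <= sqnorm2 v + sqnorm2 w.
  rewrite -big_split; apply: ler_sum => i _ /=; rewrite /GRing.scale /=.
  by rewrite -subr_ge0; have := sqr_ge0 (v i 0 - w i 0); rewrite sqrrB; lra.
have SC u : a <= u <= b -> dS u <= C * (S u + 2 * n%:R * e ^+ 2).
  move=> /EV[_ _ dEB dVB].
  have /andP[E1 E2] := sqnorm2_norm (E u); have /andP[V1 V2] := sqnorm2_norm (V u).
  have /andP[_ dE2] := sqnorm2_norm (dE u); have /andP[_ dV2] := sqnorm2_norm (dV u).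
  have H1 := sq_dot (E u) (dE u); have H2 := sq_dot (V u) (dV u).
  set p := `|E u| in dEB dVB E1 *; set q := `|V u| in dEB dVB V1 *.
  have p0 : 0 <= p by exact: normr_ge0.
  have q0 : 0 <= q by exact: normr_ge0.
  have pq : (p + q) ^+ 2 <= 2 * S u.
    have := sqr_ge0 (p - q); rewrite sqrrB sqrrD /S; lra.
  have Bpq : (B * (p + q)) ^+ 2 <= B ^+ 2 * (2 * S u).
    by rewrite exprMn ler_wpM2l ?sqr_ge0.
  have dEs : `|dE u| ^+ 2 <= 2 * B ^+ 2 * S u.
    apply: (@le_trans _ _ ((B * (p + q)) ^+ 2)).
      by rewrite lerXn2r ?nnegrE // mulr_ge0 // addr_ge0.
    by apply: le_trans Bpq _; lra.
  have dVs : `|dV u| ^+ 2 <= 4 * B ^+ 2 * S u + 2 * e ^+ 2.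
    apply: (@le_trans _ _ ((B * (p + q) + e) ^+ 2)).
      by rewrite lerXn2r ?nnegrE ?addr_ge0 // mulr_ge0 // addr_ge0.
    have := sqr_ge0 (B * (p + q) - e); rewrite sqrrB [(_ + e) ^+ 2]sqrrD; lra.
  have n0 : 0 <= n%:R :> R by [].
  have H3 := ler_wpM2l n0 dEs; have H4 := ler_wpM2l n0 dVs.
  have H5 : 0 <= 6 * n%:R * B ^+ 2 * (2 * n%:R * e ^+ 2).
    by rewrite !mulr_ge0 ?sqr_ge0.
  rewrite /C mulrDl mul1r mulrDr; rewrite /dS.
  have -> : 6 * n%:R * B ^+ 2 * S u = n%:R * (2 * B ^+ 2 * S u)
    + n%:R * (4 * B ^+ 2 * S u) by ring.
  by move: H1 H2 H3 H4 H5 dE2 dV2; rewrite mulrDr /S; lra.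
have Sa : S a <= 2 * n%:R * e ^+ 2.
  have /andP[_ E2] := sqnorm2_norm (E a); have /andP[_ V2] := sqnorm2_norm (V a).
  have Ea2 : `|E a| ^+ 2 <= e ^+ 2 by rewrite lerXn2r ?nnegrE.
  have Va2 : `|V a| ^+ 2 <= e ^+ 2 by rewrite lerXn2r ?nnegrE.
  have n0 : 0 <= n%:R :> R by [].
  have H3 := ler_wpM2l n0 Ea2; have H4 := ler_wpM2l n0 Va2.
  by rewrite /S; lra.
have H := gronwall SD SC tab.
have S0 u : 0 <= sqnorm2 (V u) by apply: sumr_ge0 => i _; exact: sqr_ge0.
have /andP[E1 _] := sqnorm2_norm (E t).
have D0 : 0 <= 2 * n%:R * e ^+ 2 by rewrite !mulr_ge0 ?sqr_ge0.
have H2 : `|E t| ^+ 2 <= (4 * n%:R * e ^+ 2) * expR (C * (t - a)).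
  apply: (@le_trans _ _ (S t + 2 * n%:R * e ^+ 2)).
    by rewrite /S; have := S0 t; lra.
  by apply: le_trans H _; rewrite ler_wpM2r ?expR_ge0 //; lra.
have {}H2 : `|E t| ^+ 2 <= 4 * n%:R * expR (C * (b - a)) * e ^+ 2.
  apply: le_trans H2 _; rewrite mulrAC -!mulrA ler_wpM2l // ler_wpM2l //.
  rewrite ler_wpM2r ?sqr_ge0 // ler_expR ler_wpM2l ?(le_trans ler01) //.
  by rewrite lerD2r; case/andP: tab.
rewrite -(ger0_norm e0) -sqrtr_sqr -sqrtrM ?mulr_ge0 ?expR_ge0 //.
by rewrite -[leLHS]ger0_norm // -sqrtr_sqr ler_wsqrtr.
Qed.

End gronwall.

(** * Invertibility of the Gram matrix *)

Lemma mulmx_tr_eq0 (R : realDomainType) m n (W : 'M[R]_(m, n)) :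
  W *m W^T = 0 -> W = 0.
Proof.
move=> W0; apply/matrixP => i j; have /matrixP/(_ i i) := W0; rewrite !mxE => /eqP.
have sq k : W i k * W^T k i = W i k ^+ 2 by rewrite mxE expr2.
under eq_bigr do rewrite sq.
rewrite psumr_eq0 => [/allP/(_ j)|k _]; last exact: sqr_ge0.
by rewrite mem_index_enum sqrf_eq0 => /(_ isT)/eqP.
Qed.

Lemma gram_unitmx (R : realFieldType) m n (A : 'M[R]_(m, n)) :
  \rank A = n -> A^T *m A \in unitmx.
Proof.
move=> rA; rewrite -row_free_unit -kermx_eq0; set K := kermx _.
have KA : K *m A^T = 0.
  apply: mulmx_tr_eq0.
  by rewrite trmx_mul trmxK mulmxA -(mulmxA K) mulmx_ker mul0mx.
have fA : row_free A^T by rewrite /row_free mxrank_tr rA.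
by apply/eqP; apply: (row_free_inj fA); rewrite KA mul0mx.
Qed.

(** * Orders of magnitude on the grid and regularity classes of families of curves *)

Section families.
Context {R : realType}.
Variables t0 T : R.
Implicit Types (V : normedModType R).

Lemma near_step : \forall rho \near +oo, (0 : R) < step rho <= 1.
Proof.
near=> rho; have r1 : 1 <= rho by [].
have s1 : 1 <= Num.sqrt rho by rewrite -sqrtr1 ler_wsqrtr.
by rewrite /step invr_gt0 (lt_le_trans ltr01 s1) /= invf_le1 // (lt_le_trans ltr01 s1).
Unshelve. all: by end_near. Qed.

Lemma near_step_le (d : R) : 0 < d -> \forall rho \near +oo, step rho <= d.
Proof.
move=> d0; near=> rho.
have rd : d^-1 ^+ 2 <= rho by [].
have dr : d^-1 <= Num.sqrt rho.
  by rewrite -[leLHS]ger0_norm ?invr_ge0 ?(ltW d0) // -sqrtr_sqr ler_wsqrtr.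
by rewrite /step -[leRHS]invrK lef_pV2 // posrE ?invr_gt0 // (lt_le_trans _ dr) ?invr_gt0.
Unshelve. all: by end_near. Qed.

(* [h = O(eps^N)] at the grid points whose [s] successors are also in [t0, T];
   [k = 0] is left out because of the initialization [u_0 = 0]. *)
Definition gridO V (s N : nat) (h : R -> nat -> V) : Prop :=
  exists C : R, \forall rho \near +oo, forall k : nat, (0 < k)%N ->
    t0 <= step rho * k%:R -> step rho * (k + s)%:R <= T ->
    `|h rho k| <= C * step rho ^+ N.

(** This and the next two classes have constants uniform in large [rho]. Sampled on the grid, their
    members have damped differences of order $\epsilon^0$, $\epsilon^1$ and $\epsilon^2$ when the
    damping is $O(\epsilon)$. *)
Definition bounded_family V (h : R -> R -> V) : Prop :=
  exists M : R, \forall rho \near +oo, forall t, t0 <= t <= T ->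
    `|h rho t| <= M.

Definition lip_family V (h : R -> R -> V) : Prop :=
  bounded_family h /\
  exists M : R, \forall rho \near +oo, forall s t, t0 <= s <= T ->
    t0 <= t <= T -> `|h rho t - h rho s| <= M * `|t - s|.

(** A uniform version of the class $C^{1,1}$: a first-order expansion with quadratic remainder, [h']
    acting as the derivative. Being free of differentiation, it is stable under sums and products by
    elementary estimates. *)
Definition quad_family V (h : R -> R -> V) : Prop :=
  bounded_family h /\ exists2 h' : R -> R -> V, bounded_family h' &
  exists M : R, \forall rho \near +oo, forall s t, t0 <= s <= T ->
    t0 <= t <= T ->
    `|h rho t - h rho s - (t - s) *: h' rho s| <= M * `|t - s| ^+ 2.

Lemma gridO_ge0 V s N (h : R -> nat -> V) : gridO s N h ->
  exists2 C : R, 0 <= C & \forall rho \near +oo, 0 < step rho <= 1 /\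
    forall k : nat, (0 < k)%N ->
    t0 <= step rho * k%:R -> step rho * (k + s)%:R <= T ->
    `|h rho k| <= C * step rho ^+ N.
Proof.
move=> [C HC]; exists `|C| => //.
have [H1 H2] := (near_step, HC); move: H1 H2.
apply: filterS2 => rho e01 H; split=> // k k0 tk kT.
have [e0 _] := andP e01.
by apply: le_trans (H k k0 tk kT) _; rewrite ler_wpM2r ?exprn_ge0 ?ler_norm // ltW.
Qed.

Lemma gridO_near V s N (h1 h2 : R -> nat -> V) :
  (\forall rho \near +oo, forall k : nat, (0 < k)%N ->
    t0 <= step rho * k%:R -> step rho * (k + s)%:R <= T ->
    h1 rho k = h2 rho k) ->
  gridO s N h1 -> gridO s N h2.
Proof.
move=> H [C HC]; exists C; move: H HC.
by apply: filterS2 => rho H HC k k0 tk kT; rewrite -H //; exact: HC.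
Qed.

Lemma eq_gridO V s N (h1 h2 : R -> nat -> V) :
  (forall rho k, h1 rho k = h2 rho k) -> gridO s N h1 -> gridO s N h2.
Proof. by move=> H; apply: gridO_near; apply: nearW. Qed.

Lemma gridO_weaken V s N s' N' (h : R -> nat -> V) :
  (s <= s')%N -> (N' <= N)%N -> gridO s N h -> gridO s' N' h.
Proof.
move=> ss NN /gridO_ge0[C C0 HC]; exists C; move: HC.
apply: filterS => rho [/andP[e0 e1] H] k k0 tk kT.
apply: le_trans (H k k0 tk _) _.
  apply: le_trans kT; rewrite ler_wpM2l ?ler_nat ?leq_add2l //; exact: ltW.
by rewrite ler_wpM2l // ler_wiXn2l // ltW.
Qed.

Lemma gridOD V s N (h1 h2 : R -> nat -> V) : gridO s N h1 -> gridO s N h2 ->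
  gridO s N (fun rho k => h1 rho k + h2 rho k).
Proof.
move=> [C1 H1] [C2 H2]; exists (C1 + C2); move: H1 H2.
apply: filterS2 => rho H1 H2 k k0 tk kT.
by rewrite mulrDl (le_trans (ler_normD _ _)) // lerD // ?H1 ?H2.
Qed.

Lemma gridON V s N (h : R -> nat -> V) : gridO s N h ->
  gridO s N (fun rho k => - h rho k).
Proof.
move=> [C H]; exists C; move: H.
by apply: filterS => rho H k k0 tk kT; rewrite normrN H.
Qed.

Lemma gridOB V s N (h1 h2 : R -> nat -> V) : gridO s N h1 -> gridO s N h2 ->
  gridO s N (fun rho k => h1 rho k - h2 rho k).
Proof. by move=> H1 /gridON; exact: gridOD. Qed.

Lemma gridOZ V s N M (a : R -> nat -> R) (h : R -> nat -> V) :
  gridO s N a -> gridO s M h -> gridO s (N + M) (fun rho k => a rho k *: h rho k).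
Proof.
move=> [C1 H1] [C2 H2]; exists (C1 * C2); move: H1 H2.
apply: filterS2 => rho H1 H2 k k0 tk kT.
by rewrite normrZ exprD mulrACA ler_pM // ?H1 ?H2.
Qed.

Lemma gridO_cst V s (v : V) : gridO s 0 (fun _ _ => v).
Proof. by exists `|v|; apply: nearW => rho k _ _ _; rewrite expr0 mulr1. Qed.

Lemma gridO_step s N : gridO s N (fun rho _ => step rho ^+ N : R).
Proof.
exists 1; have := near_step; apply: filterS => rho /andP[e0 _] k _ _ _.
by rewrite mul1r ger0_norm // exprn_ge0 // ltW.
Qed.

Lemma gridO_cstZ V s N (a : R) (h : R -> nat -> V) :
  gridO s N h -> gridO s N (fun rho k => a *: h rho k).
Proof. exact: gridOZ (gridO_cst s a). Qed.

Lemma gridO_stepZ V s N M (h : R -> nat -> V) :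
  gridO s M h -> gridO s (N + M) (fun rho k => step rho ^+ N *: h rho k).
Proof. exact: gridOZ (gridO_step s N). Qed.

Lemma gridO_divstep V s N M (h : R -> nat -> V) :
  gridO s (N + M) (fun rho k => step rho ^+ N *: h rho k) -> gridO s M h.
Proof.
move=> [C H]; exists C; have := near_step; move: H.
apply: filterS2 => rho H /andP[e0 _] k k0 tk kT; move: (H k k0 tk kT).
by rewrite normrZ ger0_norm ?exprn_ge0 ?(ltW e0) // exprD mulrCA ler_pM2l // exprn_gt0.
Qed.

Lemma gridO_mulmx p q s N (B : 'M[R]_(p, q)) (h : R -> nat -> 'cV[R]_q) :
  gridO s N h -> gridO s N (fun rho k => B *m h rho k).
Proof.
have [c c0 Bc] := mulmx_norm_le B.
move=> [C H]; exists (c * C); move: H.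
apply: filterS => rho H k k0 tk kT.
by apply: le_trans (Bc _) _; rewrite -mulrA ler_wpM2l // H.
Qed.

(** The [s] successors of node [k.+1] are among the [s.+1] successors of node [k]. *)
Lemma gridO_shift V s N (h : R -> nat -> V) : gridO s N h ->
  gridO s.+1 N (fun rho k => h rho k.+1).
Proof.
move=> [C H]; exists C; have := near_step; move: H.
apply: filterS2 => rho H /andP[e0 _] k k0 tk kT; apply: H => //; last by rewrite addSnnS.
by apply: le_trans tk _; rewrite ler_wpM2l ?ler_nat // ltW.
Qed.

Lemma grid_itv s j rho k : 0 < step rho -> (j <= s)%N ->
  t0 <= step rho * k%:R -> step rho * (k + s)%:R <= T ->
  t0 <= step rho * (k + j)%:R <= T.
Proof.
move=> e0 js tk kT; apply/andP; split.
  by apply: le_trans tk _; rewrite ler_wpM2l ?ler_nat ?leq_addr // ltW.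
by apply: le_trans _ kT; rewrite ler_wpM2l ?ler_nat ?leq_add2l // ltW.
Qed.

Lemma bounded_gridO V j (h : R -> R -> V) : bounded_family h ->
  gridO j 0 (fun rho k => h rho (step rho * (k + j)%:R)).
Proof.
move=> [M H]; exists M; have := near_step; move: H.
apply: filterS2 => rho H /andP[e0 _] k k0 tk kT; rewrite expr0 mulr1.
by apply: H; exact: grid_itv kT.
Qed.

Lemma lip_gridO V j (h : R -> R -> V) : lip_family h ->
  gridO j.+1 1 (fun rho k =>
    h rho (step rho * (k + j.+1)%:R) - h rho (step rho * (k + j)%:R)).
Proof.
move=> [_ [M H]]; exists M; have := near_step; move: H.
apply: filterS2 => rho H /andP[e0 _] k k0 tk kT.
apply: le_trans (H _ _ _ _) _; try exact: grid_itv kT.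
by rewrite -mulrBr addnS -natr1 addrAC subrr add0r mulr1 expr1 ger0_norm // ltW.
Qed.

Lemma quad_gridO V j (h : R -> R -> V) : quad_family h ->
  gridO j.+2 2 (fun rho k =>
    h rho (step rho * (k + j.+2)%:R) - h rho (step rho * (k + j.+1)%:R)
    - (h rho (step rho * (k + j.+1)%:R) - h rho (step rho * (k + j)%:R))).
Proof.
move=> [_ [h' _ [M H]]]; exists (M + M); have := near_step; move: H.
apply: filterS2 => rho H /andP[e0 _] k k0 tk kT.
set e := step rho; set t := e * _; set s := e * (k + j.+1)%:R; set u := e * (k + j)%:R.
have [tI sI uI] : [/\ t0 <= t <= T, t0 <= s <= T & t0 <= u <= T].
  split; apply: (grid_itv e0 _ tk kT) => //; rewrite ?leqnSn // leqW //.
have ts : t - s = e.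
  by rewrite /t /s -mulrBr !addnS -(natr1 (k + j).+1) addrAC subrr add0r mulr1.
have us : u - s = - e.
  by rewrite /u /s -mulrBr !addnS -(natr1 (k + j)) opprD addrA subrr add0r mulrN mulr1.
(* Both outer nodes are expanded about the middle one, and the linear terms cancel. *)
have -> : h rho t - h rho s - (h rho s - h rho u) =
    (h rho t - h rho s - (t - s) *: h' rho s) +
    (h rho u - h rho s - (u - s) *: h' rho s).
  by rewrite ts us scaleNr opprK addrACA addNr addr0 opprB.
rewrite (le_trans (ler_normD _ _)) // mulrDl lerD //.
  by apply: le_trans (H s t sI tI) _; rewrite ts ger0_norm // ltW.
by apply: le_trans (H s u sI uI) _; rewrite us normrN ger0_norm // ltW.
Qed.

End families.

(** * Closure properties of the regularity classes *)

Section family_calculus.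
Context {R : realType}.
Variables t0 T : R.
Implicit Types (V : normedModType R).
Local Notation bounded_family := (bounded_family t0 T).
Local Notation lip_family := (lip_family t0 T).
Local Notation quad_family := (quad_family t0 T).
Local Notation gridO := (gridO t0 T).

Lemma bounded_familyD V (h1 h2 : R -> R -> V) :
  bounded_family h1 -> bounded_family h2 ->
  bounded_family (fun rho t => h1 rho t + h2 rho t).
Proof.
move=> [M1 H1] [M2 H2]; exists (M1 + M2); move: H1 H2.
apply: filterS2 => rho H1 H2 t tI.
by rewrite (le_trans (ler_normD _ _)) // lerD // ?H1 ?H2.
Qed.

Lemma bounded_familyZ V (c : R -> R -> R) (h : R -> R -> V) :
  bounded_family c -> bounded_family h ->
  bounded_family (fun rho t => c rho t *: h rho t).
Proof.
move=> [M1 H1] [M2 H2]; exists (M1 * M2); move: H1 H2.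
by apply: filterS2 => rho H1 H2 t tI; rewrite normrZ ler_pM // ?H1 ?H2.
Qed.

Lemma bounded_family_mulmx p q (B : 'M[R]_(p, q)) (h : R -> R -> 'cV[R]_q) :
  bounded_family h -> bounded_family (fun rho t => B *m h rho t).
Proof.
have [c c0 Bc] := mulmx_norm_le B.
move=> [M H]; exists (c * M); move: H.
by apply: filterS => rho H t tI; rewrite (le_trans (Bc _)) // ler_wpM2l // H.
Qed.

Lemma bounded_family_ge0 V (h : R -> R -> V) : bounded_family h ->
  exists2 M : R, 0 <= M & \forall rho \near +oo, forall t, t0 <= t <= T ->
    `|h rho t| <= M.
Proof.
move=> [M H]; exists `|M| => //; move: H.
by apply: filterS => rho H t tI; rewrite (le_trans (H t tI)) // ler_norm.
Qed.

Lemma lip_familyD V (h1 h2 : R -> R -> V) :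
  lip_family h1 -> lip_family h2 ->
  lip_family (fun rho t => h1 rho t + h2 rho t).
Proof.
move=> [B1 [M1 H1]] [B2 [M2 H2]]; split; first exact: bounded_familyD.
exists (M1 + M2); move: H1 H2; apply: filterS2 => rho H1 H2 s t sI tI.
by rewrite opprD addrACA mulrDl (le_trans (ler_normD _ _)) // lerD // ?H1 ?H2.
Qed.

Lemma lip_familyZ V (c : R -> R -> R) (h : R -> R -> V) :
  lip_family c -> lip_family h ->
  lip_family (fun rho t => c rho t *: h rho t).
Proof.
move=> [B1 [M1 H1]] [B2 [M2 H2]]; split; first exact: bounded_familyZ.
move: B1 B2 => /bounded_family_ge0[N1 N10 B1] /bounded_family_ge0[N2 N20 B2].
exists (N1 * M2 + M1 * N2); near=> rho => s t sI tI.
have -> : c rho t *: h rho t - c rho s *: h rho s =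
    c rho t *: (h rho t - h rho s) + (c rho t - c rho s) *: h rho s.
  by rewrite scalerBr scalerBl addrA subrK.
rewrite (le_trans (ler_normD _ _)) // mulrDl !normrZ -mulrA (mulrAC M1).
rewrite lerD // ler_pM //.
- by move: t tI; near: rho.
- by move: s t sI tI; near: rho.
- by move: s t sI tI; near: rho.
- by move: s sI {tI}; near: rho.
Unshelve. all: by end_near. Qed.

Lemma lip_family_mulmx p q (B : 'M[R]_(p, q)) (h : R -> R -> 'cV[R]_q) :
  lip_family h -> lip_family (fun rho t => B *m h rho t).
Proof.
have [c c0 Bc] := mulmx_norm_le B.
move=> [Bh [M H]]; split; first exact: bounded_family_mulmx.
exists (c * M); move: H; apply: filterS => rho H s t sI tI.
by rewrite -mulmxBr (le_trans (Bc _)) // -mulrA ler_wpM2l // H.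
Qed.

Lemma quad_lip V (h : R -> R -> V) : quad_family h -> lip_family h.
Proof.
move=> [Bh [h' /bounded_family_ge0[N N0 Bh'] [M H]]]; split=> //.
(* One factor [|t - s|] of the quadratic remainder is bounded by the length of the interval. *)
exists (`|M| * (T - t0) + N); move: H Bh'.
apply: filterS2 => rho H Bh' s t sI tI.
rewrite -[X in `|X|](subrK ((t - s) *: h' rho s)) (le_trans (ler_normD _ _)) //.
rewrite mulrDl lerD //; last by rewrite normrZ mulrC ler_wpM2r // Bh'.
apply: le_trans (H s t sI tI) _; apply: (@le_trans _ _ (`|M| * `|t - s| ^+ 2)).
  by rewrite ler_wpM2r ?ler_norm.
rewrite expr2 mulrA ler_wpM2r // ler_wpM2l // ler_norml.
by move: sI tI => /andP[? ?] /andP[? ?]; apply/andP; split; lra.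
Qed.

Lemma quad_familyD V (h1 h2 : R -> R -> V) :
  quad_family h1 -> quad_family h2 ->
  quad_family (fun rho t => h1 rho t + h2 rho t).
Proof.
move=> [B1 [d1 D1 [M1 H1]]] [B2 [d2 D2 [M2 H2]]]; split.
  exact: bounded_familyD.
exists (fun rho t => d1 rho t + d2 rho t); first exact: bounded_familyD.
exists (M1 + M2); move: H1 H2; apply: filterS2 => rho H1 H2 s t sI tI.
rewrite scalerDr !opprD (addrACA (h1 _ _)) (addrACA (_ - _)) mulrDl.
by rewrite (le_trans (ler_normD _ _)) // lerD // ?H1 ?H2.
Qed.

Lemma quad_familyZ n (c : R -> R -> R) (h : R -> R -> 'cV[R]_n) :
  quad_family c -> quad_family h ->
  quad_family (fun rho t => c rho t *: h rho t).
Proof.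
move=> cQ hQ; have [_ [M3 H3]] := quad_lip cQ.
move: cQ hQ => [B1 [d1 D1 [M1 H1]]] [B2 [d2 D2 [M2 H2]]]; split.
  exact: bounded_familyZ.
exists (fun rho t => d1 rho t *: h rho t + c rho t *: d2 rho t).
  by apply: bounded_familyD; exact: bounded_familyZ.
move: B1 B2 D2 => /bounded_family_ge0[N1 N10 B1] /bounded_family_ge0[N2 N20 B2]
  /bounded_family_ge0[N3 N30 D2].
exists (N1 * M2 + M1 * N2 + M3 * N3); near=> rho => s t sI tI.
set hs := h rho s; set ht := h rho t; set cs := c rho s; set ct := c rho t.
(* Product rule with remainder: the last, mixed term is quadratic because [c] is Lipschitz. *)
have -> : ct *: ht - cs *: hs - (t - s) *: (d1 rho s *: hs + cs *: d2 rho s) =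
    ct *: (ht - hs - (t - s) *: d2 rho s)
    + (ct - cs - (t - s) * d1 rho s) *: hs
    + ((ct - cs) * (t - s)) *: d2 rho s.
  by apply/colP => i; rewrite !mxE; ring.
rewrite (le_trans (ler_normD _ _)) // [leRHS]mulrDl lerD //.
  rewrite (le_trans (ler_normD _ _)) // [leRHS]mulrDl lerD // normrZ.
    rewrite -mulrA ler_pM //; first by move: t @ht @ct tI; near: rho.
    by move: s t @hs @ht @cs @ct sI tI; near: rho.
  rewrite mulrAC ler_pM //; last by move: s @hs @cs sI {tI}; near: rho.
  by move: s t @hs @ht @cs @ct sI tI; near: rho.
rewrite normrZ normrM.
rewrite (_ : _ * _ * _ ^+ 2 = M3 * `|t - s| * `|t - s| * N3); last by ring.
rewrite ler_pM ?mulr_ge0 // ?ler_wpM2r //.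
  by move: s t @hs @ht @cs @ct sI tI; near: rho.
by move: s @hs @cs sI {tI}; near: rho.
Unshelve. all: by end_near. Qed.

Lemma quad_family_mulmx p q (B : 'M[R]_(p, q)) (h : R -> R -> 'cV[R]_q) :
  quad_family h -> quad_family (fun rho t => B *m h rho t).
Proof.
have [c c0 Bc] := mulmx_norm_le B.
move=> [Bh [d D [M H]]]; split; first exact: bounded_family_mulmx.
exists (fun rho t => B *m d rho t); first exact: bounded_family_mulmx.
exists (c * M); move: H; apply: filterS => rho H s t sI tI.
rewrite scalemxAr -!mulmxBr (le_trans (Bc _)) // -mulrA ler_wpM2l //; exact: H.
Qed.

Lemma quad_family_cst V (v : V) : quad_family (fun _ _ => v).
Proof.
split; first by exists `|v|; apply: nearW.
exists (fun _ _ => 0); first by exists 0; apply: nearW => ? ? _; rewrite normr0.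
by exists 0; apply: nearW => ? ? ? _ _; rewrite subrr scaler0 subrr normr0 mul0r.
Qed.

Lemma quad_family_cstZ V (a : R) (h : R -> R -> V) :
  quad_family h -> quad_family (fun rho t => a *: h rho t).
Proof.
have aB := proj1 (quad_family_cst (a : R)).
move=> [B [h' B' [M H]]]; split; first exact: bounded_familyZ.
exists (fun rho t => a *: h' rho t); first exact: bounded_familyZ.
exists (`|a| * M); move: H; apply: filterS => rho H s t sI tI.
rewrite scalerA mulrC -scalerA -!scalerBr normrZ -mulrA ler_wpM2l //.
exact: H.
Qed.

End family_calculus.

(** * Smooth families and their Taylor expansions on the grid *)

Section smooth_families.
Context {R : realType}.
Variables (n : nat) (t0 T : R).
Implicit Types Y : R -> R -> 'cV[R]_n.
Local Notation bounded_family := (bounded_family t0 T).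
Local Notation lip_family := (lip_family t0 T).
Local Notation quad_family := (quad_family t0 T).
Local Notation gridO := (gridO t0 T).

Lemma smooth_family_derivable N Y : smooth_family N t0 T Y ->
  forall j, (j < N)%N -> \forall rho \near +oo, forall t, t0 <= t <= T ->
    derivable (Y rho)^`(j)%classic t 1.
Proof.
move=> [M H] j jN; move: H; apply: filterS => rho H t tI.
by have [+ _] := H t tI; exact.
Qed.

Lemma smooth_family_bounded N Y j : smooth_family N t0 T Y -> (j <= N)%N ->
  bounded_family (fun rho => (Y rho)^`(j)%classic).
Proof.
move=> [M H] jN; exists M; move: H; apply: filterS => rho H t tI.
by have [_] := H t tI; exact.
Qed.

Lemma smooth_family_weaken N N' Y : (N' <= N)%N -> smooth_family N t0 T Y ->
  smooth_family N' t0 T Y.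
Proof.
move=> NN [M H]; exists M; move: H; apply: filterS => rho H t tI.
have [H1 H2] := H t tI; split=> j jN; first exact: H1 (leq_trans jN NN).
exact: H2 (leq_trans jN NN).
Qed.

Lemma smooth_family_derive N Y : smooth_family N.+1 t0 T Y ->
  smooth_family N t0 T (fun rho => (Y rho)^`()%classic).
Proof.
move=> [M H]; exists M; move: H; apply: filterS => rho H t tI.
have [H1 H2] := H t tI; split=> j jN; rewrite -derive1nSr; first exact: H1.
exact: H2.
Qed.

Lemma smooth_family_taylor N Y : smooth_family N t0 T Y ->
  exists2 M : R, 0 <= M & \forall rho \near +oo, forall s t, t0 <= s <= T ->
    t0 <= t <= T ->
    `|Y rho t - \sum_(j < N) ((t - s) ^+ j / j`!%:R) *: (Y rho)^`(j)%classic s|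
      <= M * `|t - s| ^+ N.
Proof.
move=> [M H]; exists `|M| => //; move: H; apply: filterS => rho H s t sI tI.
apply: (@taylor_bound R n N (Y rho) t0 T) => // u uI; have [H1 H2] := H u uI.
  exact: H1.
by apply: le_trans (H2 N _) _ => //; exact: ler_norm.
Qed.

Lemma smooth_lip Y : smooth_family 1 t0 T Y -> lip_family Y.
Proof.
move=> SY; split; first exact: (smooth_family_bounded (j := 0) SY).
have [M _ H] := smooth_family_taylor SY; exists M; move: H.
apply: filterS => rho H s t sI tI.
by have := H s t sI tI; rewrite big_ord1 expr0 fact0 divr1 scale1r expr1.
Qed.

Lemma smooth_quad Y : smooth_family 2 t0 T Y -> quad_family Y.
Proof.
move=> SY; split; first exact: (smooth_family_bounded (j := 0) SY).
exists (fun rho => (Y rho)^`()%classic); first exact: (smooth_family_bounded (j := 1) SY).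
have [M _ H] := smooth_family_taylor SY; exists M; move: H.
apply: filterS => rho H s t sI tI.
have := H s t sI tI; rewrite big_ord_recl big_ord1 /= /bump /= expr0 fact0 divr1.
by rewrite scale1r addn0 expr1 factS fact0 muln1 divr1 opprD addrA.
Qed.

Lemma smooth_taylor_gridO N Y s i j : smooth_family N t0 T Y ->
  (i <= s)%N -> (j <= s)%N ->
  gridO s N (fun rho k => Y rho (step rho * (k + i)%:R)
    - \sum_(l < N) ((step rho * (i%:R - j%:R)) ^+ l / l`!%:R)
        *: (Y rho)^`(l)%classic (step rho * (k + j)%:R)).
Proof.
move=> SY is_ js; have [M M0 H] := smooth_family_taylor SY.
exists (M * `|i%:R - j%:R| ^+ N); have := @near_step R; move: H.
apply: filterS2 => rho H /andP[e0 _] k k0 tk kT.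
have := H _ _ (grid_itv e0 js tk kT) (grid_itv e0 is_ tk kT).
have -> : step rho * (k + i)%:R - step rho * (k + j)%:R =
  step rho * (i%:R - j%:R) by rewrite !natrD; ring.
move=> /le_trans -> //.
by rewrite normrM (ger0_norm (ltW e0)) exprMn mulrA mulrAC.
Qed.

End smooth_families.

(** * From the grid to the whole interval *)

Section grid_extension.
Context {R : realType}.
Variables (n : nat) (t0 T : R).

(** Supplies the two neighbouring nodes [k] and [k.+1], both with all their [s] successors in the
    interval, from which a value at [t] is extrapolated. *)
Lemma grid_point (e t : R) s : 0 <= t0 -> 0 < e -> t0 <= t <= T ->
  e * (s + 3)%:R <= (T - t0) / 2 ->
  exists k : nat, [/\ (0 < k)%N, t0 <= e * k%:R, e * (k.+1 + s)%:R <= T &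
    `|t - e * k%:R| <= e * (s + 3)%:R].
Proof.
move=> t00 e0 /andP[t0t tT] es.
have t_ge0 : 0 <= t / e by rewrite divr_ge0 // ?(ltW e0) // (le_trans t00).
have /andP[lo hi] := truncn_itv t_ge0; set k := Num.truncn _ in lo hi.
have {}lo : e * k%:R <= t by rewrite mulrC -ler_pdivlMr.
have {}hi : t < e * k%:R + e.
  by move: hi; rewrite -natr1 ltr_pdivrMr // mulrC mulrDr mulr1.
have sR : e * (s + 3)%:R = e * s%:R + e + e + e.
  by rewrite natrD mulrDr -!addrA; congr (_ + _); ring.
have es0 : 0 <= e * s%:R by rewrite mulr_ge0 // ltW.
(* In the left half the node just after [t] is taken, with room on its right; in the right half, the
   node [s.+1] steps before the last one not exceeding [t]. *)
have [tlo|thi] := leP t ((t0 + T) / 2).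
  have kS : e * k.+1%:R = e * k%:R + e by rewrite -natr1 mulrDr mulr1.
  have kSS : e * (k.+2 + s)%:R = e * k%:R + e + e + e * s%:R.
    by rewrite natrD -natr1 !mulrDr mulr1 kS.
  exists k.+1; split => //; rewrite ?kS ?kSS.
  - lra.
  - lra.
  - by rewrite sR ler_norml; apply/andP; split; lra.
have ks : (s.+1 < k)%N.
  rewrite -(ltr_nat R) -(ltr_pM2l e0) -natr1 mulrDr mulr1.
  by lra.
have [i kE] : exists i, k = (i.+1 + s.+1)%N.
  by exists (k - s.+1).-1; rewrite prednK ?subn_gt0 // subnK // ltnW.
have kR : e * k%:R = e * i.+1%:R + e * s%:R + e.
  by rewrite kE natrD -(natr1 s) !mulrDr mulr1 addrA.
exists i.+1; split => //.
- by lra.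
- by rewrite addSnnS -kE; lra.
- by rewrite sR ler_norml; apply/andP; split; lra.
Qed.

(* A smooth function which is [O(eps^2)] at two neighbouring grid points is
   [O(eps^2)] at a bounded number of steps from them, by linear interpolation. *)
Lemma gridO_extend (P Q : R -> R -> 'cV[R]_n) s j : 0 <= t0 -> t0 < T -> (j < s)%N ->
  quad_family t0 T P -> lip_family t0 T Q ->
  gridO t0 T s 2 (fun rho k => P rho (step rho * (k + j)%:R)
     + step rho *: Q rho (step rho * (k + j)%:R)) ->
  exists C : R, \forall rho \near +oo, forall t, t0 <= t <= T ->
    `|P rho t + step rho *: Q rho t| <= C * step rho ^+ 2.
Proof.
move=> t00 t0T js [_ [P' _ [MP HP]]] [_ [MQ HQ]] /gridO_ge0[C C0 HC].
(* Distance, in steps, from [t] to the interpolation node [p]: the distance given by [grid_point]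
   plus the offset [j]. *)
pose L : R := (s + 3)%:R + j%:R.
have L0 : 0 <= L by rewrite addr_ge0.
exists ((1 + L) * C + L * C + (MP * L ^+ 2 + L * MP) + (MQ * L + L * MQ)).
have d0 : 0 < (T - t0) / 2 by rewrite divr_gt0 ?subr_gt0.
near=> rho => t tI.
have [e01 EC] : 0 < step rho <= 1 /\ forall k : nat, (0 < k)%N ->
    t0 <= step rho * k%:R -> step rho * (k + s)%:R <= T ->
    `|P rho (step rho * (k + j)%:R) +
      step rho *: Q rho (step rho * (k + j)%:R)| <= C * step rho ^+ 2.
  by near: rho.
have es : step rho * (s + 3)%:R <= (T - t0) / 2.
  rewrite -ler_pdivlMr ?ltr0n ?addn3 //; near: rho; apply: near_step_le.
  by rewrite divr_gt0 // ltr0n.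
have PP : forall s t, t0 <= s <= T -> t0 <= t <= T ->
    `|P rho t - P rho s - (t - s) *: P' rho s| <= MP * `|t - s| ^+ 2.
  by near: rho.
have QQ : forall s t, t0 <= s <= T -> t0 <= t <= T ->
    `|Q rho t - Q rho s| <= MQ * `|t - s| by near: rho.
set e := step rho in e01 EC es *.
pose E u := P rho u + e *: Q rho u.
have /andP[e0 e1] := e01.
have [k [k0 tk kT tkd]] := grid_point t00 e0 tI es.
have tk' : t0 <= e * k.+1%:R.
  by apply: le_trans tk _; rewrite ler_wpM2l ?(ltW e0) // ler_nat.
pose p := e * (k + j)%:R; pose q := e * (k.+1 + j)%:R.
have kT' : e * (k + s)%:R <= T.
  by apply: le_trans kT; rewrite ler_wpM2l ?(ltW e0) // ler_nat addSn.
have qp : q - p = e by rewrite /q /p addSn -natr1 mulrDr mulr1 addrC addKr.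
have Ep : `|E p| <= C * e ^+ 2 by exact: EC.
have Eq : `|E q| <= C * e ^+ 2 by exact: EC.
have pI : t0 <= p <= T by exact: grid_itv (ltnW js) tk kT'.
have qI : t0 <= q <= T by exact: grid_itv (ltnW js) tk' kT.
have tp : `|t - p| <= L * e.
  have -> : t - p = (t - e * k%:R) - e * j%:R by rewrite /p natrD; ring.
  rewrite (le_trans (ler_normB _ _)) // /L mulrDl lerD //.
    by rewrite [leRHS]mulrC.
  by rewrite mulrC ger0_norm // mulr_ge0 // ltW.
pose th := (t - p) / e.
have thL : `|th| <= L by rewrite normrM normfV (ger0_norm (ltW e0)) ler_pdivrMr.
have thE : th * e = t - p by rewrite /th divfK // gt_eqF.
rewrite -[X in `|X|]/(E t).
(* Affine interpolation through [p] and [q], with [th] bounded by [L] but possibly outside $[0,1]$.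
   The terms in [P'] cancel, so [P] leaves only quadratic remainders; [Q] already carries a factor
   [e], so Lipschitz increments suffice. *)
have -> : E t = ((1 - th) *: E p + th *: E q)
  + ((P rho t - P rho p - (t - p) *: P' rho p)
     - th *: (P rho q - P rho p - (q - p) *: P' rho p))
  + e *: ((Q rho t - Q rho p) - th *: (Q rho q - Q rho p)).
  by rewrite /E qp -thE; apply/colP => i; rewrite !mxE; ring.
have MP0 : 0 <= MP.
  have := le_trans (normr_ge0 _) (PP _ _ pI qI).
  by rewrite qp pmulr_lge0 // exprn_gt0 // normr_gt0 gt_eqF.
have MQ0 : 0 <= MQ.
  have := le_trans (normr_ge0 _) (QQ _ _ pI qI).
  by rewrite qp pmulr_lge0 // normr_gt0 gt_eqF.
have th1 : `|1 - th| <= 1 + L.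
  by rewrite (le_trans (ler_normB _ _)) // normr1 lerD2l.
rewrite mulrDl (le_trans (ler_normD _ _)) // lerD //.
  rewrite mulrDl (le_trans (ler_normD _ _)) // lerD //.
    rewrite mulrDl -!mulrA (le_trans (ler_normD _ _)) // lerD // normrZ ler_pM //.
  rewrite mulrDl (le_trans (ler_normB _ _)) // lerD //.
    rewrite (le_trans (PP _ _ pI tI)) // -mulrA ler_wpM2l // -exprMn.
    by rewrite lerXn2r ?nnegrE ?mulr_ge0 // ltW.
  rewrite normrZ -mulrA ler_pM //.
  by rewrite (le_trans (PP _ _ pI qI)) // qp (ger0_norm (ltW e0)).
rewrite normrZ (ger0_norm (ltW e0)) expr2 mulrA mulrC ler_wpM2r ?(ltW e0) //.
rewrite mulrDl (le_trans (ler_normB _ _)) // lerD //.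
  by rewrite (le_trans (QQ _ _ pI tI)) // -mulrA ler_wpM2l.
rewrite normrZ -mulrA ler_pM //.
by rewrite (le_trans (QQ _ _ pI qI)) // qp (ger0_norm (ltW e0)).
Unshelve. all: by end_near. Qed.

End grid_extension.

(** * Exact relations between the iterates *)

Section admm_relations.
Context {R : realType} {n m : nat}.
Variables (f : 'cV[R]_n -> R) (g : 'cV[R]_m -> R) (A : 'M[R]_(m, n)).
Variable alpha : R.

(* For [y = z] this is [z_{k+2} - zh_{k+1}], by the definition of [zh]. *)
Definition damped_diff (V : lmodType R) (gam : R) (y0 y1 y2 : V) : V :=
  y2 - y1 - gam *: (y1 - y0).

Variables (rho : R) (gam : nat -> R) (x0 : 'cV[R]_n).
Variables (x : nat -> 'cV[R]_n) (z u zh uh : nat -> 'cV[R]_m).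
Hypothesis alpha_neq0 : alpha != 0.
Hypothesis rho_neq0 : rho != 0.
Hypothesis f_diff : forall y, differentiable f y.
Hypothesis g_diff : forall y, differentiable g y.
Hypothesis iter : admm_iterates f g A alpha rho gam x0 x z u zh uh.

Local Notation G k := (gradient g (z k)).
Local Notation D y k := (damped_diff (gam k) (y k) (y k.+1) (y k.+2)).

(** Optimality in the [z]-update reads [rho^-1 *: G k.+1 = w - z k.+1], and the [u]-update sets
    [u k.+1] to this same difference. *)
Lemma admm_uE k : u k.+1 = rho^-1 *: G k.+1.
Proof.
have := admm_zS iter k; set w := _ + uh k => zmin.
have /(argmin_prox_gradient g_diff) : is_argmin
    (fun y => rho^-1 * g y + 2^-1 * sqnorm2 (1%:M *m y - w)) (z k.+1).
  by move=> y; rewrite !mul1mx; exact: zmin.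
rewrite trmx1 !mul1mx => /eqP; rewrite addr_eq0 => /eqP ->.
by rewrite (admm_uS iter) opprB /w; apply/colP => i; rewrite !mxE; ring.
Qed.

Lemma admm_zhE k : zh k.+1 = z k.+2 - D z k.
Proof. by rewrite (admm_zhS iter) /damped_diff; apply/colP => i; rewrite !mxE; ring. Qed.

(** The [u]-update with both extrapolations undone: [u k.+2 - uh k.+1] is the damped difference of
    [u], as [z k.+2 - zh k.+1] is that of [z]. Positivity of [k] makes all three values of [u]
    scaled gradients. *)
Lemma admm_constraint k : (0 < k)%N ->
  A *m x k.+2 - z k.+2 = (alpha^-1 - 1) *: D z k
    + (alpha^-1 * rho^-1) *: damped_diff (gam k) (G k) (G k.+1) (G k.+2).
Proof.
case: k => // k _; have := admm_uS iter k.+2; rewrite admm_zhE /damped_diff.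
rewrite (admm_uhS iter) !admm_uE => H.
apply: (scalerI alpha_neq0); move: H => /eqP; rewrite -subr_eq0 => /eqP.
move=> /colP H; apply/colP => i; move: (H i); rewrite !mxE => {}H.
apply/eqP; rewrite -subr_eq0; apply/eqP; rewrite -[RHS]oppr0 -[in RHS]H.
by field; rewrite rho_neq0.
Qed.

(** Optimality in the [x]-update, where [A *m x k.+2 - zh k.+1 + uh k.+1] is rewritten by
    [admm_constraint]. The bracket would be the gradient of the objective if [g] were differentiated
    at [A *m x k.+2] instead of [z k.+2]. *)
Lemma admm_stationarity k : (0 < k)%N ->
  alpha^-1 *: (A^T *m D z k)
  + (rho^-1 * (alpha^-1 - 1))
      *: (A^T *m damped_diff (gam k) (G k) (G k.+1) (G k.+2))
  + rho^-1 *: (gradient f (x k.+2) + A^T *m G k.+2) = 0.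
Proof.
move=> k0; have := argmin_prox_gradient f_diff (admm_xS iter k.+1).
move=> <-; have := admm_constraint k0.
rewrite admm_zhE (admm_uhS iter) => /eqP; rewrite subr_eq => /eqP ->.
case: k k0 => // k _; rewrite !admm_uE.
set d1 := damped_diff _ _ _ _; set d2 := damped_diff _ _ _ _.
rewrite [X in _ = _ + A^T *m X](_ : _ = alpha^-1 *: d1
   + (rho^-1 * (alpha^-1 - 1)) *: d2 + rho^-1 *: G k.+3); last first.
  by rewrite /d2 /damped_diff; apply/colP => i; rewrite !mxE; ring.
move: d1 d2 => d1 d2; rewrite !mulmxDr -!scalemxAr.
move: (A^T *m d1) (A^T *m d2) (A^T *m _) (gradient f _) => v1 v2 v3 v4.
by apply/colP => i; rewrite !mxE; ring.
Qed.

End admm_relations.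

(** * Orders of damped differences *)

Section damped_difference.
Context {R : realType}.
Variables t0 T : R.
Local Notation gridO := (gridO t0 T).
Local Notation node rho k := (step rho * (k)%:R).

(** A second difference plus a first difference weighted by the damping [1 - a]: when the damping is
    $O(\epsilon)$, both parts are $O(\epsilon^2)$ on smooth curves. *)
Lemma damped_diffE (V : lmodType R) (a : R) (y0 y1 y2 : V) :
  damped_diff a y0 y1 y2 = (y2 - y1 - (y1 - y0)) + (1 - a) *: (y1 - y0).
Proof. by rewrite /damped_diff scalerBl scale1r addrA subrK. Qed.

Lemma damped_diffD n (a : R) (y0 y1 y2 w0 w1 w2 : 'cV[R]_n) :
  damped_diff a (y0 + w0) (y1 + w1) (y2 + w2) =
  damped_diff a y0 y1 y2 + damped_diff a w0 w1 w2.
Proof. by rewrite /damped_diff; apply/colP => i; rewrite !mxE; ring. Qed.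

Lemma damped_diffZ n (a b : R) (y0 y1 y2 : 'cV[R]_n) :
  damped_diff a (b *: y0) (b *: y1) (b *: y2) = b *: damped_diff a y0 y1 y2.
Proof. by rewrite /damped_diff; apply/colP => i; rewrite !mxE; ring. Qed.

Lemma damped_diffB n (a : R) (y0 y1 y2 w0 w1 w2 : 'cV[R]_n) :
  damped_diff a (y0 - w0) (y1 - w1) (y2 - w2) =
  damped_diff a y0 y1 y2 - damped_diff a w0 w1 w2.
Proof. by rewrite /damped_diff; apply/colP => i; rewrite !mxE; ring. Qed.

Lemma mulmx_damped_diff m n (B : 'M[R]_(m, n)) (a : R) (y0 y1 y2 : 'cV[R]_n) :
  B *m damped_diff a y0 y1 y2 = damped_diff a (B *m y0) (B *m y1) (B *m y2).
Proof. by rewrite /damped_diff !mulmxBr -scalemxAr mulmxBr. Qed.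

(** No power of $\epsilon$ is gained: this serves for remainders known only by their size. *)
Lemma damped_diff_gridO n s N (a : R -> nat -> R) (h : R -> nat -> 'cV[R]_n) :
  gridO s.+2 0 a -> gridO s N h ->
  gridO s.+2 N (fun rho k => damped_diff (a rho k) (h rho k) (h rho k.+1) (h rho k.+2)).
Proof.
move=> aO hO; have h1 := gridO_shift hO; have h2 := gridO_shift h1.
have {}h1 := gridO_weaken (leqnSn _) (leqnn N) h1.
have {}hO := gridO_weaken (leqW (leqnSn _)) (leqnn N) hO.
apply: gridOB; first exact: gridOB h2 h1.
exact: (gridOZ aO (gridOB h1 hO)).
Qed.

Lemma damped_diff_lip_gridO n s j (a : R -> nat -> R) (Y : R -> R -> 'cV[R]_n) :
  (j.+2 <= s)%N -> gridO s 1 (fun rho k => 1 - a rho k) -> lip_family t0 T Y ->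
  gridO s 1 (fun rho k => damped_diff (a rho k) (Y rho (node rho (k + j)))
    (Y rho (node rho (k + j.+1))) (Y rho (node rho (k + j.+2)))).
Proof.
move=> js aO lipY.
have d1 := gridO_weaken (ltnW js) (leqnn 1) (lip_gridO j lipY).
have d2 := gridO_weaken js (leqnn 1) (lip_gridO j.+1 lipY).
apply: (eq_gridO (fun rho k => esym (damped_diffE _ _ _ _))).
apply: gridOD; first exact: gridOB d2 d1.
exact: (gridO_weaken (leqnn s) _ (gridOZ aO d1)).
Qed.

Lemma damped_diff_quad_gridO n s j (a : R -> nat -> R) (Y : R -> R -> 'cV[R]_n) :
  (j.+2 <= s)%N -> gridO s 1 (fun rho k => 1 - a rho k) -> quad_family t0 T Y ->
  gridO s 2 (fun rho k => damped_diff (a rho k) (Y rho (node rho (k + j)))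
    (Y rho (node rho (k + j.+1))) (Y rho (node rho (k + j.+2)))).
Proof.
move=> js aO quadY.
have d1 := gridO_weaken (ltnW js) (leqnn 1) (lip_gridO j (quad_lip quadY)).
have d2 := gridO_weaken js (leqnn 2) (quad_gridO j quadY).
apply: (eq_gridO (fun rho k => esym (damped_diffE _ _ _ _))).
by apply: gridOD => //; exact: (gridOZ aO d1).
Qed.

End damped_difference.

Lemma taylor_sum4 {R : realType} (V : lmodType R) (h : R) (v : nat -> V) :
  \sum_(j < 4) (h ^+ j / j`!%:R) *: v j =
  v 0%N + h *: v 1%N + (h ^+ 2 / 2) *: v 2 + (h ^+ 3 / 6) *: v 3.
Proof.
by rewrite !big_ord_recr big_ord0 /= add0r expr0 expr1 fact0 divr1 scale1r
  (_ : 1`! = 1)%N // divr1.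
Qed.

(** * Taylor expansion of the damped difference *)

Section damping_expansion.
Context {R : realType}.
Variables (t0 T : R) (gam : R -> nat -> R) (c d : R -> R).
Local Notation gridO := (gridO t0 T).
Local Notation node rho k := (step rho * (k)%:R).
Hypothesis c_quad : quad_family t0 T (fun _ => c).
Hypothesis d_lip : lip_family t0 T (fun _ => d).
(** The coefficients are evaluated at node [k + 1], the centre of the difference
    [damped_diff (gam rho k)]. *)
Hypothesis gam_expansion : gridO 1 3 (fun rho k =>
  1 - gam rho k
  - (step rho * c (node rho (k + 1)) + step rho ^+ 2 * d (node rho (k + 1)))).

Lemma damping_gridO : gridO 1 1 (fun rho k => 1 - gam rho k).
Proof.
have cO := bounded_gridO 1 (proj1 c_quad); have dO := bounded_gridO 1 (proj1 d_lip).
have H1 := gridO_stepZ 1 cO; have H2 := gridO_stepZ 2 dO.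
have {}H2 := gridO_weaken (leqnn 1) (isT : 1 <= 2 + 0)%N H2.
have H3 := gridO_weaken (leqnn 1) (isT : 1 <= 3)%N gam_expansion.
apply: eq_gridO (gridOD H3 (gridOD H1 H2)) => rho k.
by rewrite /GRing.scale /= expr1 subrK.
Qed.

Lemma gam_gridO : gridO 1 0 gam.
Proof.
have H := gridO_weaken (leqnn 1) (leq0n 1) damping_gridO.
by apply: eq_gridO (gridOB (gridO_cst t0 T 1 (1 : R)) H) => rho k; rewrite /= opprB addrCA subrr addr0.
Qed.

Definition diff_main n (Y : R -> R -> 'cV[R]_n) (rho t : R) : 'cV[R]_n :=
  (Y rho)^`(2)%classic t + c t *: (Y rho)^`()%classic t.

Definition diff_corr n (Y : R -> R -> 'cV[R]_n) (rho t : R) : 'cV[R]_n :=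
  d t *: (Y rho)^`()%classic t - (c t / 2) *: (Y rho)^`(2)%classic t.

Lemma diff_main_quad n (Y : R -> R -> 'cV[R]_n) :
  smooth_family 4 t0 T Y -> quad_family t0 T (diff_main Y).
Proof.
move=> SY; have S1 := smooth_family_derive SY; have S2 := smooth_family_derive S1.
apply: quad_familyD; first exact: smooth_quad S2.
by apply: quad_familyZ => //; apply: smooth_quad; exact: smooth_family_weaken S1.
Qed.

Lemma diff_corr_lip n (Y : R -> R -> 'cV[R]_n) :
  smooth_family 4 t0 T Y -> lip_family t0 T (diff_corr Y).
Proof.
move=> SY; have S1 := smooth_family_derive SY; have S2 := smooth_family_derive S1.
have c2 : lip_family t0 T (fun _ t => - (c t / 2)).
  have := lip_familyZ (quad_lip (quad_family_cst t0 T (- 2^-1 : R))) (quad_lip c_quad).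
  congr lip_family; apply/funext => rho; apply/funext => t.
  by rewrite /GRing.scale /=; ring.
have -> : diff_corr Y = fun rho t => d t *: (Y rho)^`()%classic t
    + (- (c t / 2)) *: (Y rho)^`(2)%classic t.
  by apply/funext => rho; apply/funext => t; rewrite /diff_corr scaleNr.
apply: lip_familyD; apply: lip_familyZ => //; apply: smooth_lip.
  exact: smooth_family_weaken S1.
exact: smooth_family_weaken S2.
Qed.

(** About the middle node the second difference is symmetric, so it has no $\epsilon^3$ term. The
    first difference is a backward one, $\epsilon Y'-\frac{\epsilon^2}{2}Y''+O(\epsilon^3)$, and
    this is the source of $-\frac c2 Y''$ in [diff_corr]. *)
Lemma damped_diff_expansion n (Y : R -> R -> 'cV[R]_n) : smooth_family 4 t0 T Y ->
  gridO 2 4 (fun rho k =>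
    damped_diff (gam rho k) (Y rho (node rho (k + 0))) (Y rho (node rho (k + 1)))
      (Y rho (node rho (k + 2)))
    - step rho ^+ 2 *: (diff_main Y rho (node rho (k + 1))
                      + step rho *: diff_corr Y rho (node rho (k + 1)))).
Proof.
move=> SY.
pose Yj j rho k := (Y rho)^`(j)%classic (node rho (k + 1)%N).
pose rp rho k := Y rho (node rho (k + 2)) - (Yj 0%N rho k + step rho *: Yj 1%N rho k
  + (step rho ^+ 2 / 2) *: Yj 2 rho k + (step rho ^+ 3 / 6) *: Yj 3 rho k).
pose rm rho k := Y rho (node rho (k + 0)) - (Yj 0%N rho k - step rho *: Yj 1%N rho k
  + (step rho ^+ 2 / 2) *: Yj 2 rho k - (step rho ^+ 3 / 6) *: Yj 3 rho k).
have rpO : gridO 2 4 rp.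
  apply: eq_gridO (smooth_taylor_gridO (i := 2) (j := 1) (s := 2) SY isT isT) => rho k.
  by rewrite (taylor_sum4 _ (fun l => Yj l rho k)) (_ : step rho * (2%:R - 1%:R) = step rho); last ring.
have rmO : gridO 2 4 rm.
  apply: eq_gridO (smooth_taylor_gridO (i := 0) (j := 1) (s := 2) SY isT isT) => rho k.
  rewrite (taylor_sum4 _ (fun l => Yj l rho k)) (_ : step rho * (0%:R - 1%:R) = - step rho); last by ring.
  by rewrite sqrrN exprNn -signr_odd expr1 mulN1r mulNr !scaleNr.
pose ga rho k := 1 - gam rho k
  - (step rho * c (node rho (k + 1)) + step rho ^+ 2 * d (node rho (k + 1))).
(* What the backward difference leaves after its terms in $Y'$ and $Y''$. *)
pose w rho k := (step rho ^+ 3 / 6) *: Yj 3 rho k - rm rho k.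
have YjO j : (j <= 4)%N -> gridO 2 0 (Yj j).
  move=> j4; exact: gridO_weaken (bounded_gridO 1 (smooth_family_bounded SY j4)).
have wO : gridO 2 3 w.
  apply: gridOB; last exact: gridO_weaken rmO.
  apply: eq_gridO (gridO_cstZ 6^-1 (gridO_stepZ 3 (YjO 3 isT))) => rho k.
  by rewrite scalerA mulrC.
have cO : gridO 2 0 (fun rho k => c (node rho (k + 1))).
  exact: gridO_weaken (bounded_gridO 1 (proj1 c_quad)).
have dO : gridO 2 0 (fun rho k => d (node rho (k + 1))).
  exact: gridO_weaken (bounded_gridO 1 (proj1 d_lip)).
have dY : gridO 2 1 (fun rho k => Y rho (node rho (k + 1)) - Y rho (node rho (k + 0))).
  apply: gridO_weaken (lip_gridO 0 _) => //; apply: smooth_lip.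
  exact: smooth_family_weaken SY.
have gaO : gridO 2 3 ga by exact: gridO_weaken gam_expansion.
have H1 := gridOZ gaO dY.
have H2 := gridO_stepZ 4 (gridOZ dO (YjO 2 isT)).
have H3 := gridO_stepZ 1 (gridOZ cO wO).
have H4 := gridO_weaken (leqnn 2) (isT : 4 <= 2 + (0 + 3))%N
   (gridO_stepZ 2 (gridOZ dO wO)).
(* The exact remainder: [rp + rm], then $(\epsilon c+\epsilon^2 d)w$, then [ga] times the backward
   difference, minus $\frac{\epsilon^4}{2}dY''$. *)
have := gridOD (gridOD (gridOD rpO rmO) (gridOD H3 H4)) (gridOB H1 (gridO_cstZ 2^-1 H2)).
apply: eq_gridO => rho k.
rewrite /diff_main /diff_corr -!/(Yj _ rho k) /w damped_diffE.
have Yp : Y rho (node rho (k + 2)) = rp rho k + (Yj 0%N rho k + step rho *: Yj 1%N rho k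
  + (step rho ^+ 2 / 2) *: Yj 2 rho k + (step rho ^+ 3 / 6) *: Yj 3 rho k).
  by rewrite /rp subrK.
have Ym : Y rho (node rho (k + 0)) = rm rho k + (Yj 0%N rho k - step rho *: Yj 1%N rho k
  + (step rho ^+ 2 / 2) *: Yj 2 rho k - (step rho ^+ 3 / 6) *: Yj 3 rho k).
  by rewrite /rm subrK.
have -> : 1 - gam rho k = ga rho k
  + (step rho * c (node rho (k + 1)) + step rho ^+ 2 * d (node rho (k + 1))).
  by rewrite /ga subrK.
rewrite Yp Ym -[Y rho (node rho (k + 1))]/(Yj 0%N rho k)
  -[(Y rho)^`()%classic _]/(Yj 1%N rho k).
move: (rp rho k) (rm rho k) (ga rho k) => vp vm vg.
move: (Yj 0%N rho k) (Yj 1%N rho k) (Yj 2 rho k) (Yj 3 rho k) => y0 y1 y2 y3.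
move: (c _) (d _) => cc dd; move: (step rho) => e.
by apply/colP => i; rewrite !mxE; field.
Qed.

End damping_expansion.

Lemma lipschitz_bound {R : realType} (V W : normedModType R) (F : V -> W) :
  lipschitz F -> exists2 L : R, 0 <= L &
    forall v w, `|F v - F w| <= L * `|v - w|.
Proof.
move=> /pinfty_ex_gt0[L L0 LF]; exists L; first exact: ltW.
by move=> v w; exact: (LF (v, w)).
Qed.

(** The exact equation for [y] minus that for [x] with its residual. The left side is the derivative
    of the quantity [V] in [ode_solution_close]; the right side contains no Hessian terms outside
    the residual. *)
Lemma modified_ode_diff {R : realType} n (M : 'M[R]_n) (a b e : R)
    (y2 y1 hy gy x2 x1 hx gx : 'cV[R]_n) :
  M *m (y2 + a *: y1) + e *: hy = - (b *: gy) ->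
  M *m (y2 - x2) + e *: (hy - hx) =
    - (a *: (M *m (y1 - x1))) - b *: (gy - gx)
    - (M *m (x2 + a *: x1) + e *: hx - - (b *: gx)).
Proof.
rewrite !(mulmxDr, mulmxN) -!scalemxAr.
move: (M *m y2) (M *m y1) (M *m x2) (M *m x1) => v1 v2 v3 v4 /colP H.
apply/colP => i; move: (H i); rewrite !mxE => {}H.
by apply/eqP; rewrite -subr_eq0; apply/eqP; move/eqP: H; rewrite -subr_eq0 => /eqP <-; ring.
Qed.

(** * Residual of the modified equation along the interpolating curve *)

Section modified_equation.
Context {R : realType} {n m : nat}.
Variables (f : 'cV[R]_n -> R) (g : 'cV[R]_m -> R) (A : 'M[R]_(m, n)) (alpha : R).
Hypothesis f_C2 : twice_continuously_differentiable f.
Hypothesis g_C2 : twice_continuously_differentiable g.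
Hypothesis f_lip : lipschitz (gradient f).
Hypothesis g_lip : lipschitz (gradient g).
Hypothesis alpha_gt0 : 0 < alpha.

Local Notation phi := (objective f g A).

Lemma gradient_phi x : gradient phi x = gradient f x + A^T *m gradient g (A *m x).
Proof.
have [fd _ _] := f_C2; have [gd _ _] := g_C2.
exact: gradient_objective.
Qed.

Lemma gradient_phi_differentiable x : differentiable (gradient phi) x.
Proof.
have [_ fd _] := f_C2; have [_ gd _] := g_C2.
rewrite (_ : gradient phi = gradient f + (mulmx A^T \o (gradient g \o mulmx A))).
  apply: differentiableD => //; apply: differentiable_comp; last first.
    exact: mulmx_differentiable.
  by apply: differentiable_comp => //; exact: mulmx_differentiable.
by apply/funext => y; rewrite gradient_phi.
Qed.

Lemma gradient_phi_lipschitz : exists2 L : R, 0 <= L &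
  forall x y, `|gradient phi x - gradient phi y| <= L * `|x - y|.
Proof.
have [Lf Lf0 Hf] := lipschitz_bound f_lip; have [Lg Lg0 Hg] := lipschitz_bound g_lip.
have [a a0 Ha] := mulmx_norm_le A; have [b b0 Hb] := mulmx_norm_le A^T.
exists (Lf + b * (Lg * a)); first by rewrite addr_ge0 // !mulr_ge0.
move=> x y; rewrite !gradient_phi opprD addrACA -mulmxBr.
rewrite (le_trans (ler_normD _ _)) // mulrDl lerD //.
rewrite (le_trans (Hb _)) // -mulrA ler_wpM2l // (le_trans (Hg _ _)) //.
by rewrite -mulrA ler_wpM2l // -mulmxBr.
Qed.

Section residual.
Variables (t0 T : R) (gam : R -> nat -> R) (a : R -> R -> R) (b c d : R -> R).
Local Notation gridO := (gridO t0 T).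
Local Notation node rho k := (step rho * (k)%:R).
Hypothesis c_quad : quad_family t0 T (fun _ => c).
Hypothesis d_lip : lip_family t0 T (fun _ => d).
Hypothesis gam_expansion : gridO 1 3 (fun rho k =>
  1 - gam rho k
  - (step rho * c (node rho (k + 1)) + step rho ^+ 2 * d (node rho (k + 1)))).
Hypothesis aE : forall rho t, t0 <= t <= T ->
  a (step rho) t = c t + step rho * (d t + c t ^+ 2 / 2).
Hypothesis bE : forall t, t0 <= t <= T -> b t = c t / 2.

Variables (x0 : 'cV[R]_n).
Variables (x : R -> nat -> 'cV[R]_n) (z u zh uh : R -> nat -> 'cV[R]_m).
Variables (X : R -> R -> 'cV[R]_n) (Z : R -> R -> 'cV[R]_m).
Hypothesis t0_ge0 : 0 <= t0.
Hypothesis t0T : t0 < T.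
Hypothesis iter : forall rho, 0 < rho ->
  admm_iterates f g A alpha rho (gam rho) x0 (x rho) (z rho) (u rho) (zh rho) (uh rho).
Hypothesis xzE : \forall rho \near +oo, forall k : nat, t0 <= node rho k <= T ->
  X rho (node rho k) = x rho k /\ Z rho (node rho k) = z rho k.
Hypothesis X_smooth : smooth_family 4 t0 T X.
Hypothesis Z_smooth : smooth_family 4 t0 T Z.
Hypothesis gphi_smooth : smooth_family 2 t0 T (fun rho t => gradient phi (X rho t)).
Hypothesis gg_smooth : smooth_family 2 t0 T (fun rho t => gradient g (Z rho t)).

Local Notation Dx rho i k := (damped_diff (gam rho i) (x rho k) (x rho k.+1) (x rho k.+2)).
Local Notation Dz rho i k := (damped_diff (gam rho i) (z rho k) (z rho k.+1) (z rho k.+2)).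
Local Notation G rho k := (gradient g (z rho k)).
Local Notation DG rho k := (damped_diff (gam rho k) (G rho k) (G rho k.+1) (G rho k.+2)).
Local Notation S Y rho t := (diff_main c Y rho t + step rho *: diff_corr c d Y rho t).

Let near_nodes s : \forall rho \near +oo, forall k, (0 < k)%N -> t0 <= node rho k ->
  node rho (k + s) <= T -> forall j, (j <= s)%N ->
  X rho (node rho (k + j)) = x rho (k + j) /\ Z rho (node rho (k + j)) = z rho (k + j).
Proof.
have e01 := @near_step R; move: xzE e01; apply: filterS2 => rho H /andP[e0 _] k k0 tk kT j js.
by apply: H; exact: grid_itv kT.
Qed.

Let DxO : gridO 2 4 (fun rho k => Dx rho k k - step rho ^+ 2 *: S X rho (node rho (k + 1))).
Proof.
have H := damped_diff_expansion c_quad d_lip gam_expansion X_smooth.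
apply: gridO_near H; move: (near_nodes 2); apply: filterS => rho H k k0 tk kT.
have {}H j j2 := proj1 (H k k0 tk kT j j2).
by rewrite (H 0 isT) (H 1 isT) (H 2 isT) addn0 addn1 addn2.
Qed.

Let DzO : gridO 2 4 (fun rho k => Dz rho k k - step rho ^+ 2 *: S Z rho (node rho (k + 1))).
Proof.
have H := damped_diff_expansion c_quad d_lip gam_expansion Z_smooth.
apply: gridO_near H; move: (near_nodes 2); apply: filterS => rho H k k0 tk kT.
have {}H j j2 := proj2 (H k k0 tk kT j j2).
by rewrite (H 0 isT) (H 1 isT) (H 2 isT) addn0 addn1 addn2.
Qed.

Let gam0 s : (0 < s)%N -> gridO s 0 gam.
Proof. by move=> s0; exact: gridO_weaken (gam_gridO c_quad d_lip gam_expansion). Qed.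

Let gam1 s : (0 < s)%N -> gridO s 1 (fun rho k => 1 - gam rho k).
Proof. by move=> s0; exact: gridO_weaken (damping_gridO c_quad d_lip gam_expansion). Qed.

Let DGO : gridO 2 2 (fun rho k => DG rho k).
Proof.
have H := damped_diff_quad_gridO (j := 0) (isT : 1 < 2)%N (gam1 (isT : 0 < 2)%N)
  (smooth_quad gg_smooth).
apply: gridO_near H; move: (near_nodes 2); apply: filterS => rho H k k0 tk kT.
have {}H j j2 := proj2 (H k k0 tk kT j j2).
by rewrite (H 0 isT) (H 1 isT) (H 2 isT) addn0 addn1 addn2.
Qed.

(* [gap k = A x_{k+2} - z_{k+2}], and [gap'] is what remains of it after its
   smooth leading term is removed. *)
Let gap rho k : 'cV[R]_m := (alpha^-1 - 1) *: Dz rho k k + (alpha^-1 * step rho ^+ 2) *: DG rho k.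

Let stepV : \forall rho \near +oo, (0 : R) < rho /\ rho^-1 = step rho ^+ 2.
Proof.
near=> rho; have r0 : 0 < rho by [].
by split=> //; rewrite /step exprVn sqr_sqrtr // ltW.
Unshelve. all: by end_near. Qed.

Let gapE : \forall rho \near +oo, forall k, (0 < k)%N ->
  A *m x rho k.+2 - z rho k.+2 = gap rho k.
Proof.
have [fd _ _] := f_C2; have [gd _ _] := g_C2.
move: stepV; apply: filterS => rho [r0 re] k k0.
by rewrite (admm_constraint (lt0r_neq0 alpha_gt0) (lt0r_neq0 r0) gd (iter r0) k0) re.
Qed.

Let gap' rho k : 'cV[R]_m := (alpha^-1 - 1) *: (Dz rho k k - step rho ^+ 2 *: S Z rho (node rho (k + 1)))
  + alpha^-1 *: (step rho ^+ 2 *: DG rho k).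

Let gap'O : gridO 2 4 gap'.
Proof. by apply: gridOD; apply: gridO_cstZ => //; exact: gridO_stepZ DGO. Qed.

Let S_gridO s : (0 < s)%N -> gridO s 0 (fun rho k => S Z rho (node rho (k + 1))).
Proof.
move=> s0; have mO := bounded_gridO 1 (proj1 (diff_main_quad c_quad Z_smooth)).
have cO := bounded_gridO 1 (proj1 (diff_corr_lip c_quad d_lip Z_smooth)).
apply: gridOD; first exact: gridO_weaken mO.
exact: gridO_weaken (gridO_stepZ 1 cO).
Qed.

Let gapO : gridO 2 2 gap.
Proof.
have H := gridOD (gridO_weaken (leqnn 2) (isT : 2 <= 4)%N gap'O)
  (gridO_cstZ (alpha^-1 - 1) (gridO_stepZ 2 (S_gridO (isT : 0 < 2)%N))).
apply: eq_gridO H => rho k; by rewrite /gap' /gap scalerBr !scalerA addrAC subrK.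
Qed.

(** The remainder [gap'] is small enough to be differenced without gain. In the smooth part, of size
    $\epsilon^2$, [diff_main] gains two powers, and [diff_corr] gains one besides the factor
    $\epsilon$ it carries. *)
Let DgapO : gridO 4 4 (fun rho k => damped_diff (gam rho k.+2)
  (gap rho k) (gap rho k.+1) (gap rho k.+2)).
Proof.
have g0 : gridO 4 0 (fun rho k => gam rho k.+2).
  exact: gridO_weaken (gridO_shift (gridO_shift (gam0 (isT : 0 < 1)%N))).
have g1 : gridO 4 1 (fun rho k => 1 - gam rho k.+2).
  exact: gridO_weaken (gridO_shift (gridO_shift (gam1 (isT : 0 < 1)%N))).
have H1 := damped_diff_gridO g0 gap'O.
have H2 := damped_diff_quad_gridO (j := 1) (isT : 2 < 4)%N g1
  (diff_main_quad c_quad Z_smooth).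
have H3 := damped_diff_lip_gridO (j := 1) (isT : 2 < 4)%N g1
  (diff_corr_lip c_quad d_lip Z_smooth).
have := gridOD H1 (gridO_cstZ (alpha^-1 - 1)
  (gridO_stepZ 2 (gridOD H2 (gridO_stepZ 1 H3)))).
apply: eq_gridO => rho k; rewrite expr1 -damped_diffZ -damped_diffD -!damped_diffZ -damped_diffD.
by rewrite /gap' /gap !addn1 addn2 addn3; congr damped_diff;
  rewrite scalerBr !scalerA addrAC subrK.
Qed.

(** The difference of $x_{k+2},x_{k+3},x_{k+4}$ is centred at node $k+3$, and the gradient at
    $x_{k+4}$ is expanded about that same node. *)
Lemma scheme_residual : gridO 4 2 (fun rho k =>
  (alpha^-1 *: (A^T *m A)) *m S X rho (node rho (k + 3))
  + (gradient phi (X rho (node rho (k + 3)))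
     + step rho *: (fun s => gradient phi (X rho s))^`()%classic (node rho (k + 3)))).
Proof.
have [L L0 HL] := lipschitz_bound g_lip.
have [fd _ _] := f_C2; have [gd _ _] := g_C2.
have gap4 : gridO 4 2 (fun rho k => A *m x rho k.+4 - z rho k.+4).
  apply: gridO_near (gridO_shift (gridO_shift gapO)).
  by move: gapE; apply: filterS => rho H k k0 _ _; rewrite H.
have Dgap4 : gridO 4 4 (fun rho k => A *m Dx rho k.+2 k.+2 - Dz rho k.+2 k.+2).
  apply: gridO_near DgapO; move: gapE; apply: filterS => rho H k k0 _ _.
  by rewrite -!H // damped_diffB mulmx_damped_diff.
have gradO : gridO 4 2 (fun rho k => gradient g (A *m x rho k.+4) - G rho k.+4).
  have [C HC] := gap4; exists (L * C); move: HC; apply: filterS => rho H k k0 tk kT.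
  by rewrite (le_trans (HL _ _)) // -mulrA ler_wpM2l // H.
have DG4 : gridO 4 2 (fun rho k => DG rho k.+2) := gridO_shift (gridO_shift DGO).
(* Stationarity with [A x] in place of [z]: the errors are the damped difference of the gap, the
   term in [DG] and the change of argument in the gradient of [g], the last two carrying a factor
   $\epsilon^2$. *)
have stat : gridO 4 4 (fun rho k => alpha^-1 *: (A^T *m (A *m Dx rho k.+2 k.+2))
    + step rho ^+ 2 *: gradient phi (x rho k.+4)).
  have H := gridOD (gridOB (gridO_cstZ alpha^-1 (gridO_mulmx A^T Dgap4))
     (gridO_cstZ (alpha^-1 - 1) (gridO_stepZ 2 (gridO_mulmx A^T DG4))))
     (gridO_stepZ 2 (gridO_mulmx A^T gradO)).
  apply: gridO_near H; move: stepV; apply: filterS => rho [r0 re] k k0 _ _.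
  have := admm_stationarity (lt0r_neq0 alpha_gt0) (lt0r_neq0 r0) fd gd (iter r0)
    (ltn0Sn k.+1).
  rewrite re gradient_phi.
  move: (A *m Dx _ _ _) (Dz _ _ _) (DG _ _) => w1 w2 w3; rewrite !mulmxBr.
  move: (A^T *m w1) (A^T *m w2) (A^T *m w3) => v1 v2 v3.
  move: (A^T *m gradient g (A *m _)) (A^T *m G _ _) (gradient f _) => v4 v5 v6 /colP H.
  apply/colP => i; move: (H i); rewrite !mxE => {}H.
  by apply/eqP; rewrite -subr_eq0; apply/eqP; rewrite -[RHS]oppr0 -[in RHS]H; ring.
have Dx4 := gridO_shift (gridO_shift DxO).
have phiO : gridO 4 2 (fun rho k => gradient phi (X rho (node rho (k + 4)))
   - (gradient phi (X rho (node rho (k + 3)))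
     + step rho *: (fun s => gradient phi (X rho s))^`()%classic (node rho (k + 3)))).
  have := smooth_taylor_gridO (i := 4) (j := 3) (s := 4) gphi_smooth isT isT.
  apply: eq_gridO => rho k; rewrite big_ord_recl big_ord1 /= /bump /= addn0.
  rewrite (_ : step rho * (4%:R - 3%:R) = step rho); last by ring.
  by rewrite expr0 expr1 fact0 (_ : 1`! = 1)%N // !divr1 scale1r.
apply: (gridO_divstep (N := 2)).
have := gridOB stat (gridOD (gridO_cstZ alpha^-1 (gridO_mulmx A^T (gridO_mulmx A Dx4)))
  (gridO_stepZ 2 phiO)).
apply: gridO_near; move: (near_nodes 4); apply: filterS => rho H k k0 tk kT.
have {}H j j2 := proj1 (H k k0 tk kT j j2).
rewrite (H 4 isT) !addn1 !(addnS k) !addn0.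
move: (Dx _ _ _) (diff_main _ _ _ _) (diff_corr _ _ _ _ _) => w1 w2 w3.
rewrite -scalemxAl -mulmxA !(mulmxBr, mulmxDr, =^~ scalemxAr).
move: (A^T *m (A *m w1)) (A^T *m (A *m w2)) (A^T *m (A *m w3)) => v1 v2 v3.
move: (gradient _ (x _ _)) (gradient _ (X _ _)) (derive1 _ _) => v4 v5 v6.
by apply/colP => i; rewrite !mxE; ring.
Qed.

Let M : 'M[R]_n := alpha^-1 *: (A^T *m A).
Let Phi rho t : 'cV[R]_n := gradient phi (X rho t).
Let dPhi rho t : 'cV[R]_n := (Phi rho)^`()%classic t.

(** [PE] and [QE] split the residual of the equation by powers of $\epsilon$, in the form and with
    the regularity that [gridO_extend] asks for. *)
Let PE rho t : 'cV[R]_n := M *m diff_main c X rho t + Phi rho t.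
Let QE rho t : 'cV[R]_n := M *m ((d t + c t ^+ 2 / 2) *: (X rho)^`()%classic t)
  + (dPhi rho t + (c t / 2) *: Phi rho t).

Let c2_quad : quad_family t0 T (fun _ t => c t / 2).
Proof.
have := quad_family_cstZ 2^-1 c_quad.
by congr quad_family; apply/funext => rho; apply/funext => t; rewrite /GRing.scale /= mulrC.
Qed.

Let ode_residualE : \forall rho \near +oo, forall t, t0 <= t <= T ->
  ode_lhs f g A alpha (step rho) (a (step rho)) (X rho) t
  - ode_rhs f g A (step rho) b (X rho) t = PE rho t + step rho *: QE rho t.
Proof.
have := smooth_family_derivable X_smooth (isT : 0 < 4)%N.
apply: filterS => rho dX t tI.
have H : dPhi rho t = hessian phi (X rho t) *m (X rho)^`()%classic t.
  rewrite /dPhi derive1E; apply: derive_val.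
  apply: is_derive_gradient; first exact: gradient_phi_differentiable.
  by apply: is_derive_derive1; exact: dX.
rewrite /ode_lhs /ode_rhs -H aE // bE // /PE /QE /diff_main -/M -/(Phi rho t) !mulmxDr -!scalemxAr.
move: (M *m _) (M *m _) (dPhi rho t) (Phi rho t) => v1 v2 v3 v4.
by apply/colP => i; rewrite !mxE; ring.
Qed.

Let PE_quad : quad_family t0 T PE.
Proof.
apply: quad_familyD; last exact: smooth_quad gphi_smooth.
exact: quad_family_mulmx (diff_main_quad c_quad X_smooth).
Qed.

Let dX_quad : quad_family t0 T (fun rho => (X rho)^`()%classic).
Proof.
by apply: smooth_quad; exact: smooth_family_weaken (smooth_family_derive X_smooth).
Qed.

Let dPhi_lip : lip_family t0 T dPhi.
Proof. by apply: smooth_lip; exact: smooth_family_derive gphi_smooth. Qed.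

Let QE_lip : lip_family t0 T QE.
Proof.
apply: lip_familyD.
  apply: lip_family_mulmx; apply: lip_familyZ; last exact: quad_lip dX_quad.
  apply: lip_familyD => //.
  have := lip_familyZ (quad_lip c_quad) (quad_lip c2_quad).
  congr lip_family; apply/funext => rho; apply/funext => t.
  by rewrite /GRing.scale /= expr2 mulrA.
apply: lip_familyD => //; apply: lip_familyZ; first exact: quad_lip c2_quad.
exact: quad_lip (smooth_quad gphi_smooth).
Qed.

Let PQ_gridO : gridO 4 2 (fun rho k => PE rho (node rho (k + 3))
  + step rho *: QE rho (node rho (k + 3))).
Proof.
have c2O := gridO_weaken (isT : 3 <= 4)%N (leqnn 0) (bounded_gridO 3 (proj1 c2_quad)).
have H1 := gridO_weaken (leqnn 4) (isT : 2 <= 1 + (0 + 2))%N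
  (gridO_stepZ 1 (gridOZ c2O scheme_residual)).
have B1 := bounded_gridO 3 (bounded_family_mulmx M
  (proj1 (diff_corr_lip c_quad d_lip X_smooth))).
have H2 := gridOZ c2O (gridOD (gridO_weaken (isT : 3 <= 4)%N (leqnn 0) B1)
  (gridO_weaken (isT : 3 <= 4)%N (leqnn 0) (bounded_gridO 3 (proj1 dPhi_lip)))).
(* The scheme residual multiplied by $1+\frac{\epsilon c}{2}$, less the bounded $\epsilon^2$ term
   [H2] created by the product. *)
have := gridOB (gridOD scheme_residual H1) (gridO_stepZ 2 H2).
apply: eq_gridO => rho k; set p := node rho (k + 3).
rewrite -/M -/(dPhi rho p) -/(Phi rho p) /PE /QE /diff_corr /diff_main.
rewrite !(mulmxBr, mulmxDr, =^~ scalemxAr).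
move: (M *m _) (M *m _) (dPhi rho p) (Phi rho p) (c p) (d p) => v1 v2 v3 v4 cp dp.
by apply/colP => i; rewrite !mxE; field.
Qed.

Lemma ode_residual_bound : exists C : R, \forall rho \near +oo, forall t,
  t0 <= t <= T ->
  `|ode_lhs f g A alpha (step rho) (a (step rho)) (X rho) t
    - ode_rhs f g A (step rho) b (X rho) t| <= C * step rho ^+ 2.
Proof.
have [C HC] := gridO_extend t0_ge0 t0T (isT : 3 < 4)%N PE_quad QE_lip PQ_gridO.
exists C; move: HC ode_residualE; apply: filterS2 => rho HC HE t tI.
by rewrite HE //; exact: HC.
Qed.

(** * Distance to the solutions of the modified equation *)

Hypothesis A_full_column_rank : \rank A = n.

Let M_unit : M \in unitmx.
Proof.
rewrite /M -mul_scalar_mx unitmx_mul gram_unitmx // andbT unitmxE det_scalar.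
by rewrite unitfE expf_neq0 // invr_neq0 // gt_eqF.
Qed.

(* [V = M E' + eps (Phi(Y) - Phi(X))] absorbs the Hessian term, which is not
   Lipschitz when [f] and [g] are merely [C^2]. *)
Lemma ode_solution_close (Y : R -> R -> 'cV[R]_n) :
  (\forall rho \near +oo,
     ode_solution f g A alpha (step rho) (a (step rho)) b t0 T (Y rho)) ->
  (exists K : R, \forall rho \near +oo,
     `|Y rho t0 - X rho t0| <= K * step rho ^+ 2 /\
     `|(Y rho)^`()%classic t0 - (X rho)^`()%classic t0| <= K * step rho ^+ 2) ->
  exists C : R, \forall rho \near +oo, forall t, t0 <= t <= T ->
    `|Y rho t - X rho t| <= C * step rho ^+ 2.
Proof.
move=> Ysol [K Yinit].
have [L L0 HL] := gradient_phi_lipschitz.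
have [C1 HC1] := ode_residual_bound.
have [ka ka0 Hka] := mulmx_norm_le (invmx M); have [mu mu0 Hmu] := mulmx_norm_le M.
have [Mc Mc0 HMc] := bounded_family_ge0 (proj1 c_quad).
have [Md Md0 HMd] := bounded_family_ge0 (proj1 d_lip).
(* Bounds for [a] and for [1 + e * b] when the step [e] is at most 1. *)
pose Ca := Mc + (Md + Mc ^+ 2); pose Cb := 1 + Mc.
have Ca0 : 0 <= Ca by rewrite !addr_ge0 // exprn_ge0.
have Cb0 : 0 <= Cb by rewrite addr_ge0.
pose B := ka * (1 + L) + (Ca * (1 + L) + Cb * L).
have L1 : 0 <= 1 + L by rewrite addr_ge0.
have B0 : 0 <= B by rewrite !addr_ge0 // mulr_ge0.
have [S S0 HS] := stability n t0 T B0.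
(* The three summands dominate the residual, the initial value of [E] and the initial value of
   [V]. *)
pose D := `|C1| + (`|K| + (mu * `|K| + L * `|K|)).
have D0 : 0 <= D by rewrite !addr_ge0 // mulr_ge0.
exists (S * D).
have dX : \forall rho \near +oo, forall t, t0 <= t <= T ->
    derivable (X rho) t 1 /\ derivable (X rho)^`()%classic t 1.
  have dX1 := smooth_family_derivable X_smooth (isT : 0 < 4)%N.
  have dX2 := smooth_family_derivable X_smooth (isT : 1 < 4)%N.
  by move: dX1 dX2; apply: filterS2 => rho H1 H2 t tI; split; [exact: H1|exact: H2].
near=> rho => t tI; rewrite -mulrA.
set e := step rho.
have /andP[e0 e1] : 0 < e <= 1 by rewrite /e; near: rho; exact: near_step.
have e2 : 0 <= e ^+ 2 by rewrite exprn_ge0 // ltW.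
have solY : ode_solution f g A alpha e (a e) b t0 T (Y rho).
  by rewrite /e; near: rho; exact: Ysol.
have resX : forall t, t0 <= t <= T ->
  `|ode_lhs f g A alpha e (a e) (X rho) t - ode_rhs f g A e b (X rho) t| <= C1 * e ^+ 2.
  by rewrite /e; near: rho; exact: HC1.
have [iY0 iY1] : `|Y rho t0 - X rho t0| <= K * e ^+ 2 /\
  `|(Y rho)^`()%classic t0 - (X rho)^`()%classic t0| <= K * e ^+ 2.
  by rewrite /e; near: rho; exact: Yinit.
have XD : forall t, t0 <= t <= T ->
    derivable (X rho) t 1 /\ derivable (X rho)^`()%classic t 1.
  by near: rho; exact: dX.
have cM : forall t, t0 <= t <= T -> `|c t| <= Mc by near: rho; exact: HMc.
have dM : forall t, t0 <= t <= T -> `|d t| <= Md by near: rho; exact: HMd.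
pose E s := Y rho s - X rho s.
pose dE s := (Y rho)^`()%classic s - (X rho)^`()%classic s.
pose Delta s := gradient phi (Y rho s) - gradient phi (X rho s).
pose V s := M *m dE s + e *: Delta s.
pose dV s := M *m ((Y rho)^`(2)%classic s - (X rho)^`(2)%classic s)
  + e *: (hessian phi (Y rho s) *m (Y rho)^`()%classic s
        - hessian phi (X rho s) *m (X rho)^`()%classic s).
have DL s : `|Delta s| <= L * `|E s| by exact: HL.
have eD s : `|e *: Delta s| <= L * `|E s|.
  by rewrite normrZ (ger0_norm (ltW e0)) (le_trans (ler_piMl _ e1)).
have VE s : `|V s - e *: Delta s| <= (1 + L) * (`|E s| + `|V s|).
  rewrite (le_trans (ler_normB _ _)) // mulrDl mul1r mulrDr.
  by have := mulr_ge0 L0 (normr_ge0 (V s)); have := normr_ge0 (E s); have := eD s; lra.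
apply: (HS (D * e ^+ 2) E V dE dV _ _ _ _ t tI); first by rewrite mulr_ge0.
- move=> s sI; have [Y1 Y2 Ys] := solY s sI.
  have eqV : M *m dE s = V s - e *: Delta s by rewrite /V addrK.
  have aB : `|a e s| <= Ca.
    rewrite /e aE // /Ca (le_trans (ler_normD _ _)) // lerD ?cM //.
    rewrite normrM (ger0_norm (ltW e0)) (le_trans (ler_piMl _ e1)) //.
    rewrite (le_trans (ler_normD _ _)) // lerD ?dM // normrM normrX.
    rewrite [`|2^-1|]ger0_norm // (le_trans (ler_piMr _ _)) ?exprn_ge0 //; first by lra.
    by rewrite lerXn2r ?nnegrE // cM.
  have bB : `|1 + e * b s| <= Cb.
    rewrite (le_trans (ler_normD _ _)) // normr1 lerD2l normrM (ger0_norm (ltW e0)).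
    rewrite (le_trans (ler_piMl _ e1)) // bE // normrM [`|2^-1|]ger0_norm //.
    by rewrite (le_trans (ler_piMr _ _)) ?cM //; lra.
  have EV0 : 0 <= `|E s| + `|V s| by rewrite addr_ge0.
  split.
  + exact: is_deriveB (is_derive_derive1 Y1) (is_derive_derive1 (XD s sI).1).
  + have gY := gradient_phi_differentiable (Y rho s).
    have gX := gradient_phi_differentiable (X rho s).
    have DY := is_derive_gradient gY (is_derive_derive1 Y1).
    have DX := is_derive_gradient gX (is_derive_derive1 (XD s sI).1).
    have Y'' := is_derive_derive1 Y2; have X'' := is_derive_derive1 (XD s sI).2.
    have D1 := is_derive_mulmx M (is_deriveB Y'' X'').
    exact: is_deriveD D1 (is_deriveZ e (is_deriveB DY DX)).
  (* Full column rank enters here: [M] is invertible, so [E'] is recovered from [V] and [E]. *)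
  + have -> : dE s = invmx M *m (V s - e *: Delta s) by rewrite -eqV mulKmx.
    rewrite (le_trans (Hka _)) // (le_trans (ler_wpM2l ka0 (VE s))) // mulrA.
    by rewrite ler_wpM2r // /B lerDl addr_ge0 // mulr_ge0.
  + have -> : dV s = - (a e s *: (V s - e *: Delta s)) - (1 + e * b s) *: Delta s
       - (ode_lhs f g A alpha e (a e) (X rho) s - ode_rhs f g A e b (X rho) s).
      rewrite -eqV /dV /dE /Delta; move: Ys; rewrite /ode_lhs /ode_rhs -/M.
      exact: modified_ode_diff.
    rewrite (le_trans (ler_normB _ _)) // lerD //; last first.
      rewrite (le_trans (resX s sI)) // ler_wpM2r // (le_trans (ler_norm _)) //.
      by rewrite /D lerDl !addr_ge0 // mulr_ge0.
    rewrite (le_trans (ler_normB _ _)) // normrN !normrZ.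
    have H1 := ler_pM (normr_ge0 _) (normr_ge0 _) aB (VE s).
    have H2 := ler_pM (normr_ge0 _) (normr_ge0 _) bB (DL s).
    rewrite (le_trans (lerD H1 H2)) // /B.
    have H3 : 0 <= ka * (1 + L) * (`|E s| + `|V s|) by rewrite !mulr_ge0.
    have H4 : 0 <= Cb * (L * `|V s|) by rewrite !mulr_ge0.
    rewrite -subr_ge0; apply: le_trans (addr_ge0 H3 H4) _.
    by rewrite le_eqVlt; apply/orP; left; apply/eqP; ring.
- rewrite (le_trans iY0) // ler_wpM2r // (le_trans (ler_norm _)) //.
  by rewrite /D addrCA lerDl !addr_ge0 // mulr_ge0.
- rewrite /V (le_trans (ler_normD _ _)) // /D.
  have H1 : `|M *m dE t0| <= mu * `|K| * e ^+ 2.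
    rewrite (le_trans (Hmu _)) // -mulrA ler_wpM2l // (le_trans iY1) //.
    by rewrite ler_wpM2r // ler_norm.
  have H2 : `|e *: Delta t0| <= L * `|K| * e ^+ 2.
    rewrite (le_trans (eD _)) // -mulrA ler_wpM2l // (le_trans iY0) //.
    by rewrite ler_wpM2r // ler_norm.
  have H3 : 0 <= `|C1| * e ^+ 2 by rewrite mulr_ge0.
  have H4 : 0 <= `|K| * e ^+ 2 by rewrite mulr_ge0.
  rewrite (le_trans (lerD H1 H2)) // !mulrDl.
  by rewrite addrA lerDr addr_ge0.
Unshelve. all: by end_near. Qed.

End residual.
End modified_equation.

(** * Reduction to an expansion of the damping coefficient *)

Section modified_equation_of_expansion.
Context {R : realType} {n m : nat}.
Variables (f : 'cV[R]_n -> R) (g : 'cV[R]_m -> R) (A : 'M[R]_(m, n)) (alpha : R).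

Lemma modified_equation_of_expansion (gam : R -> nat -> R) (a : R -> R -> R)
    (b c d : R -> R) :
  twice_continuously_differentiable f -> twice_continuously_differentiable g ->
  lipschitz (gradient f) -> lipschitz (gradient g) ->
  \rank A = n -> 0 < alpha ->
  (forall t0 T : R, 0 <= t0 -> t0 < T ->
     [/\ quad_family t0 T (fun _ => c), lip_family t0 T (fun _ => d) &
         gridO t0 T 1 3 (fun rho k => 1 - gam rho k
           - (step rho * c (step rho * (k + 1)%:R)
              + step rho ^+ 2 * d (step rho * (k + 1)%:R)))]) ->
  (forall e t, 0 <= t -> a e t = c t + e * (d t + c t ^+ 2 / 2)) ->
  (forall t, 0 <= t -> b t = c t / 2) ->
  modified_equation f g A alpha gam a b.
Proof.
move=> fC2 gC2 fL gL rA al0 cdE aE bE x0 t0 T x z u zh uh X Z U Zh Uh t00 t0T iter.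
move=> grid SX SZ _ _ _ Sphi Sg.
have [cQ dL gE] := cdE t0 T t00 t0T.
have pos t : t0 <= t <= T -> 0 <= t by move=> /andP[+ _]; exact: le_trans.
have aE' rho t : t0 <= t <= T -> a (step rho) t = c t + step rho * (d t + c t ^+ 2 / 2).
  by move=> /pos; exact: aE.
have bE' t : t0 <= t <= T -> b t = c t / 2 by move=> /pos; exact: bE.
have xzE : \forall rho \near +oo, forall k : nat, t0 <= step rho * k%:R <= T ->
    X rho (step rho * k%:R) = x rho k /\ Z rho (step rho * k%:R) = z rho k.
  by move: grid; apply: filterS => rho H k /H[].
split.
  exact: (ode_residual_bound fC2 gC2 gL al0 cQ dL gE aE' bE' t00 t0T iter xzE SX SZ Sphi Sg).
move=> Y Ysol Yinit.
have [C HC] := ode_solution_close fC2 gC2 fL gL al0 cQ dL gE aE' bE' t00 t0T iter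
  xzE SX SZ Sphi Sg rA Ysol Yinit.
exists C; move: HC xzE; apply: filterS2 => rho HC HE k kI.
by rewrite -(HE k kI).1; exact: HC.
Qed.

End modified_equation_of_expansion.

(** * Expansions of the two damping coefficients *)

Section coefficients.
Context {R : realType}.

Lemma inv_time_quad (t0 T : R) : 0 <= t0 ->
  quad_family t0 T (fun _ t => (t + 1)^-1 : R).
Proof.
move=> t00.
have inv1 t : t0 <= t <= T -> 0 < (t + 1)^-1 <= 1.
  move=> /andP[t0t _]; have t1 : 1 <= t + 1 by rewrite lerDr (le_trans t00).
  by rewrite invr_gt0 (lt_le_trans ltr01) //= invf_le1 // (lt_le_trans ltr01).
split.
  exists 1; apply: nearW => rho t /inv1/andP[i0 i1].
  by rewrite ger0_norm // ltW.
exists (fun _ t => - (t + 1)^-1 ^+ 2).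
  exists 1; apply: nearW => rho t /inv1/andP[i0 i1].
  by rewrite normrN normrX expr_le1 // ger0_norm // ltW.
exists 1; apply: nearW => rho s t sI tI.
have /andP[is0 is1] := inv1 s sI; have /andP[it0 it1] := inv1 t tI.
have s1 : s + 1 != 0 by rewrite -invr_eq0 gt_eqF.
have t1 : t + 1 != 0 by rewrite -invr_eq0 gt_eqF.
have -> : (t + 1)^-1 - (s + 1)^-1 - (t - s) *: (- (s + 1)^-1 ^+ 2) =
   (t + 1)^-1 * (s + 1)^-1 ^+ 2 * (t - s) ^+ 2.
  by rewrite /GRing.scale /=; field; rewrite s1 t1.
rewrite normrM normrX ler_wpM2r ?exprn_ge0 // ger0_norm.
  by rewrite mulr_ile1 ?exprn_ge0 ?exprn_ile1 // ltW.
by rewrite mulr_ge0 ?exprn_ge0 // ltW.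
Qed.

(** With $\tau=\epsilon(k+1)+1$ the damping is $\epsilon r/(\tau+\epsilon(r-1))$, expanded as a
    geometric series in $\epsilon(r-1)/\tau$; the shift from $r$ to $r-1$ comes from centring at
    $k+1$. The remainder is exactly $r(r-1)^2\epsilon^3/(\tau^2(\tau+\epsilon(r-1)))$, with
    denominator at least 1. *)
Lemma nesterov_expansion (r t0 T : R) : 0 < r -> 0 <= t0 ->
  gridO t0 T 1 3 (fun rho k =>
    1 - (k%:R + Num.sqrt rho) / (k%:R + r + Num.sqrt rho)
    - (step rho * (r / (step rho * (k + 1)%:R + 1))
       + step rho ^+ 2 * (- (r * (r - 1)) / (step rho * (k + 1)%:R + 1) ^+ 2))).
Proof.
move=> r_gt0 t00; exists `|r * (r - 1) ^+ 2|; near=> rho => k k0 tk _.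
have r0 : 0 < rho by [].
have e0 : 0 < step rho by rewrite /step invr_gt0 sqrtr_gt0.
have -> : Num.sqrt rho = (step rho)^-1 by rewrite /step invrK.
set e := step rho in e0 tk *; rewrite natrD.
have ek : 0 <= e * k%:R by exact: le_trans tk.
have p1 : 1 <= 1 + e * k%:R + e * r by rewrite -addrA lerDl addr_ge0 // mulr_ge0 // ltW.
have q1 : 1 <= e * (k%:R + 1) + 1 by rewrite lerDr mulr_ge0 ?addr_ge0 // ltW.
have p0 := lt_le_trans ltr01 p1; have q0 := lt_le_trans ltr01 q1.
have -> : 1 - (k%:R + e^-1) / (k%:R + r + e^-1)
    - (e * (r / (e * (k%:R + 1) + 1))
       + e ^+ 2 * (- (r * (r - 1)) / (e * (k%:R + 1) + 1) ^+ 2))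
  = r * (r - 1) ^+ 2 * e ^+ 3 /
      ((e * (k%:R + 1) + 1) ^+ 2 * (1 + e * k%:R + e * r)).
  by field; rewrite !gt_eqF.
rewrite normrM [`|_ * e ^+ 3|]normrM (ger0_norm (exprn_ge0 3 (ltW e0))).
rewrite ler_piMr ?mulr_ge0 ?exprn_ge0 ?(ltW e0) //.
rewrite ger0_norm ?invr_ge0 ?mulr_ge0 ?exprn_ge0 ?(ltW p0) ?(ltW q0) //.
rewrite invf_le1 ?mulr_gt0 ?exprn_gt0 //.
by rewrite -[leLHS]mulr1 ler_pM // exprn_ege1.
Unshelve. all: by end_near. Qed.

End coefficients.

Theorem proposition16 (R : realType) (n m : nat)
    (f : 'cV[R]_n -> R) (g : 'cV[R]_m -> R) (A : 'M[R]_(m, n)) (alpha r : R)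
    (f_convex : convex_function [set: 'cV[R]_n] f)
    (g_convex : convex_function [set: 'cV[R]_m] g)
    (f_C2 : twice_continuously_differentiable f)
    (g_C2 : twice_continuously_differentiable g)
    (f_lip : lipschitz (gradient f))
    (g_lip : lipschitz (gradient g))
    (A_full_column_rank : \rank A = n)
    (phi_min : exists xmin, forall x, objective f g A xmin <= objective f g A x)
    (alpha_gt0 : 0 < alpha) (r_gt0 : 0 < r) :
  (* R-A-ADMM *)
  modified_equation f g A alpha
    (fun rho k => (k%:R + Num.sqrt rho) / (k%:R + r + Num.sqrt rho))
    (fun eps t => r / (t + 1) - eps * r * (r - 2) / (2 * (t + 1) ^+ 2))
    (fun t => r / (2 * (t + 1)))
  /\
  (* R-HB-ADMM *)
  modified_equation f g A alpha
    (fun rho _ => 1 - r / Num.sqrt rho)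
    (fun eps _ => r + eps * r ^+ 2 / 2)
    (fun _ => r / 2).
Proof.
split.
- apply: (modified_equation_of_expansion (c := fun t => r / (t + 1))
    (d := fun t => - (r * (r - 1)) / (t + 1) ^+ 2)) => //.
  + move=> t0 T t00 t0T; have iQ := inv_time_quad T t00; split.
    * by have := quad_family_cstZ r iQ.
    * have iL := quad_lip iQ.
      have := lip_familyZ (quad_lip (quad_family_cst t0 T (- (r * (r - 1)) : R)))
        (lip_familyZ iL iL).
      congr lip_family; apply/funext => rho; apply/funext => t.
      by rewrite /GRing.scale /= -invfM.
    * exact: nesterov_expansion.
  + move=> e t t0; have t1 : t + 1 != 0 by rewrite gt_eqF // ltr_wpDl.
    by field.
  + move=> t t0; have t1 : t + 1 != 0 by rewrite gt_eqF // ltr_wpDl.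
    by field.
- apply: (modified_equation_of_expansion (c := fun=> r) (d := fun=> 0)) => //.
  + move=> t0 T t00 t0T; split; first exact: quad_family_cst.
      exact: quad_lip (quad_family_cst _ _ _).
    (* Here the damping equals $\epsilon r$ exactly, so the constant is 0. *)
    exists 0; have := @near_step R; apply: filterS => rho /andP[e0 _] k _ _ _.
    rewrite (_ : _ - _ - _ = 0) ?normr0 ?mul0r //.
    by rewrite /step; ring.
  + by move=> e t _; field.
Qed.
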